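(* Let $M$ be a Carathéodory hyperbolic complex manifold. Then there exists a bounded real-analytic strictly plurisubharmonic function $\varphi: M\to\mathbb{R}$.
   Context: Let $\Delta\subset\mathbb{C}$ be the unit disk with the Poincaré norm $\|v\|_P=|v|/(1-|z|^2)$ for $v\in T_z\Delta\cong\mathbb{C}$. For a complex manifold $M$, the infinitesimal Carathéodory pseudo-metric is $E_M(x,v)=\sup\{\|df_x(v)\|_P : f:M\to\Delta \text{ holomorphic}, f(x)=0\}$ for $x\in M$, $v\in T_xM$ (holomorphic tangent vectors). $M$ is called Carathéodory hyperbolic if $E_M(x,v)>0$ for all $x\in M$ and all $v\in T_xM\setminus\{0\}$. *)

(* Defs.v *)
From mathcomp Require Import all_boot all_order all_algebra.
From mathcomp Require Import all_classical all_reals all_analysis.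
From mathcomp Require Import complex.

Set Implicit Arguments.
Unset Strict Implicit.
Unset Printing Implicit Defensive.

Import Order.TTheory GRing.Theory Num.Theory numFieldNormedType.Exports.

Local Open Scope classical_set_scope.
Local Open Scope ring_scope.

(* Through the name [CC R] (rather than R[i] itself) the complex numbers and
   the spaces 'rV[CC R]_n get their normed-module structures over [CC R]: below,
   [differentiable] and ['d] are therefore complex differentiability and the
   complex-linear differential. *)
Definition CC (R : realType) : numClosedFieldType := R[i].

Definition re (R : realType) (z : CC R) : R := complex.Re z.
Definition im (R : realType) (z : CC R) : R := complex.Im z.
Definition mkC (R : realType) (a b : R) : CC R := Complex a b.
Definition modC (R : realType) (z : CC R) : R := ComplexField.Normc.normc z.

(** * Complex manifolds *)

(* A homeomorphism from the open set [dom] of T onto an open set of C^n.  Both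
   maps are total functions, whose values outside [dom] and outside
   [to_coord @` dom] are irrelevant. *)
Record chart (R : realType) (n : nat) (T : topologicalType) := Chart {
  dom : set T;
  to_coord : T -> 'rV[CC R]_n;
  of_coord : 'rV[CC R]_n -> T;
  dom_open : open dom;
  cod_open : open (to_coord @` dom);
  to_coordK : forall x, dom x -> of_coord (to_coord x) = x;
  to_coord_continuous : forall x, dom x -> {for x, continuous to_coord};
  of_coord_continuous :
    forall z, (to_coord @` dom) z -> {for z, continuous of_coord} }.

Record complex_manifold (R : realType) (n : nat) := ComplexManifold {
  carrier :> topologicalType;
  manifold_hausdorff : hausdorff_space carrier;
  manifold_second_countable : @second_countable carrier;
  atlas : set (chart R n carrier);
  atlas_cover : forall x : carrier, exists2 c, atlas c & dom c x;
  atlas_holomorphic : forall c d, atlas c -> atlas d ->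
    forall x, dom c x -> dom d x ->
      differentiable (to_coord d \o of_coord c) (to_coord c x) }.

Definition holomorphic (R : realType) (n : nat) (M : complex_manifold R n)
    (f : M -> CC R) : Prop :=
  forall c, atlas c -> forall x : M, dom c x ->
    differentiable (f \o of_coord c) (to_coord c x).

(* A representative of a holomorphic tangent vector at x: a chart around x
   together with the coordinates of the vector in it.  Two representatives
   (c, v) and (d, w) define the same tangent vector iff
   w = 'd (to_coord d \o of_coord c) (to_coord c x) v; in particular the
   tangent vector is nonzero iff [tcoord] is. *)
Record tangent (R : realType) (n : nat) (M : complex_manifold R n) (x : M) :=
  Tangent {
    tchart : chart R n M;
    tchart_atlas : atlas tchart;
    tchart_dom : dom tchart x;
    tcoord : 'rV[CC R]_n }.

Definition mdiff (R : realType) (n : nat) (M : complex_manifold R n)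
    (f : M -> CC R) (x : M) (v : tangent x) : CC R :=
  'd (f \o of_coord (tchart v)) (to_coord (tchart v) x) (tcoord v).

(** * The Caratheodory pseudo-metric *)

Definition poincare_norm (R : realType) (z w : CC R) : R :=
  modC w / (1 - modC z ^+ 2).

Definition to_disk (R : realType) (n : nat) (M : complex_manifold R n)
    (f : M -> CC R) : Prop :=
  holomorphic f /\ forall y : M, modC (f y) < 1.

Definition caratheodory (R : realType) (n : nat) (M : complex_manifold R n)
    (x : M) (v : tangent x) : \bar R :=
  ereal_sup [set (poincare_norm (f x) (mdiff f v))%:E
            | f in [set f : M -> CC R | to_disk f /\ f x = 0]].

Definition caratheodory_hyperbolic (R : realType) (n : nat)
    (M : complex_manifold R n) : Prop :=
  forall (x : M) (v : tangent x), tcoord v != 0 -> (0 < caratheodory v)%E.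

(** * Real-analytic functions *)

(* The 2n real coordinates of a vector of C^n. *)
Definition rcoord (R : realType) (n : nat) (h : 'rV[CC R]_n)
    (i : 'I_n + 'I_n) : R :=
  match i with inl j => re (h 0 j) | inr j => im (h 0 j) end.

(* Sum of an absolutely summable real family: the nonnegative-family sum
   [esum] of the library is applied to the positive and negative parts. *)
Definition has_sum (R : realType) (I : choiceType) (u : I -> R) (s : R)
    : Prop :=
  let U := fun i => (u i)%:E in
  summable setT U /\ s%:E = (esum setT U^\+ - esum setT U^\-)%E.

(* f is, near p, the sum of a convergent power series in 2n real variables. *)
Definition real_analytic_at (R : realType) (n : nat)
    (f : 'rV[CC R]_n -> R) (p : 'rV[CC R]_n) : Prop :=
  exists (a : {ffun 'I_n + 'I_n -> nat} -> R) (r : R), 0 < r /\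
    forall h : 'rV[CC R]_n, (forall i, `|rcoord h i| < r) ->
      has_sum (fun m => a m * \prod_i rcoord h i ^+ m i) (f (p + h)).

Definition real_analytic (R : realType) (n : nat) (M : complex_manifold R n)
    (phi : M -> R) : Prop :=
  forall c, atlas c -> forall x : M, dom c x ->
    real_analytic_at (phi \o of_coord c) (to_coord c x).

(** * Strictly plurisubharmonic functions *)

(* Derivative of g at z along the real direction v. *)
Definition rderive (R : realType) (n : nat) (g : 'rV[CC R]_n -> CC R)
    (v z : 'rV[CC R]_n) : CC R :=
  mkC (derive1 (fun t : R => re (g (z + mkC t 0 *: v))) 0)
      (derive1 (fun t : R => im (g (z + mkC t 0 *: v))) 0).

(* d/dz_j = (d/dx_j - i d/dy_j) / 2 *)
Definition wirtinger (R : realType) (n : nat) (j : 'I_n)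
    (g : 'rV[CC R]_n -> CC R) (z : 'rV[CC R]_n) : CC R :=
  (rderive g (delta_mx 0 j) z
   - mkC 0 1 * rderive g (mkC 0 1 *: delta_mx 0 j) z) / 2%:R.

(* d/d(conj z_j) = (d/dx_j + i d/dy_j) / 2 *)
Definition wirtinger_bar (R : realType) (n : nat) (j : 'I_n)
    (g : 'rV[CC R]_n -> CC R) (z : 'rV[CC R]_n) : CC R :=
  (rderive g (delta_mx 0 j) z
   + mkC 0 1 * rderive g (mkC 0 1 *: delta_mx 0 j) z) / 2%:R.

Definition levi_form (R : realType) (n : nat) (f : 'rV[CC R]_n -> R)
    (p v : 'rV[CC R]_n) : CC R :=
  \sum_(j < n) \sum_(k < n)
    wirtinger j (wirtinger_bar k (fun z => mkC (f z) 0)) p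
      * v 0 j * (v 0 k)^*.

(* Meant for functions of class C^2.  In the order of [CC R], [0 < z] says that
   z is real and positive. *)
Definition strictly_plurisubharmonic (R : realType) (n : nat)
    (M : complex_manifold R n) (phi : M -> R) : Prop :=
  forall c, atlas c -> forall x : M, dom c x ->
    forall v : 'rV[CC R]_n, v != 0 ->
      0 < levi_form (phi \o of_coord c) (to_coord c x) v.

Definition bounded_function (R : realType) (T : Type) (phi : T -> R) : Prop :=
  exists B : R, forall x, `|phi x| <= B.

(* Main.v *)
(* On a Caratheodory hyperbolic manifold the differentials at a point of the
   holomorphic maps to the disc have no common kernel, so finitely many of them
   suffice there, and, by continuity, on a neighbourhood.  As the topology has a
   countable basis, some sequence (f_a) of maps to the disc is such that at no
   point a nonzero tangent vector is killed by all df_a.  Then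
   phi = sum_a c_a |f_a|^2, with summable weights c_a > 0, is bounded by the sum
   of the weights, and its Levi form sum_a c_a |df_a(v)|^2 is positive.

   Both analyticity and the differentiation under the sum rest on Cauchy's
   formula.  It is proved by Goursat's bisection argument, applied to trapezoid
   sums on the homotopy z + s (w - z) that shrinks a circle to z, and stated with
   a finitely additive mean over the circle.  Iterated over a torus it expands
   f_a(p + X + iY) conj (f_a(p + conj (X - iY))), which is holomorphic in the
   complex variables X and Y, with coefficient bounds independent of a. *)
Require Import Defs.
From mathcomp Require Import all_boot all_order all_algebra.
From mathcomp Require Import all_classical all_reals all_analysis.
From mathcomp Require Import complex finmap.
From mathcomp Require Import ring lra.

Set Implicit Arguments.
Unset Strict Implicit.
Unset Printing Implicit Defensive.

Import Order.TTheory GRing.Theory Num.Theory numFieldNormedType.Exports.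

Local Open Scope classical_set_scope.
Local Open Scope ring_scope.

(** * Complex numbers *)

(** The obstacle is to differentiate and expand an infinite sum of functions that are only known to
    be complex differentiable at each point. Sums over the family, averages over circles and point
    evaluations are therefore treated as one notion, a positive functional of mass at most 1 on
    bounded functions. Such functionals can be nested, and an estimate that is uniform in the index
    passes through them by linearity and positivity alone.

    Cauchy's formula gives a function bounded by 1 a first-order expansion whose quadratic remainder
    has a constant depending only on the radius. These expansions are averaged over the family, and
    the Wirtinger derivatives of the average are read off as the coefficients of t and of its
    conjugate. The same Cauchy averages show that first derivatives vary continuously. The
    definition of a holomorphic map does not contain this, and the passage from nondegeneracy at a
    point to nondegeneracy on a neighbourhood rests on it. *)

Section ComplexNumbers.
Variable R : realType.
Implicit Types (z w : CC R) (a b t : R).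

Lemma CC_ext z w : re z = re w -> im z = im w -> z = w.
Proof. by case: z w => a b [c d] /= -> ->. Qed.

Lemma reD z w : re (z + w) = re z + re w. Proof. by case: z w => a b []. Qed.
Lemma imD z w : im (z + w) = im z + im w. Proof. by case: z w => a b []. Qed.
Lemma reN z : re (- z) = - re z. Proof. by case: z. Qed.
Lemma imN z : im (- z) = - im z. Proof. by case: z. Qed.
Lemma reB z w : re (z - w) = re z - re w. Proof. by rewrite reD reN. Qed.
Lemma reM z w : re (z * w) = re z * re w - im z * im w.
Proof. by case: z w => a b []. Qed.
Lemma imM z w : im (z * w) = re z * im w + im z * re w.
Proof. by case: z w => a b []. Qed.
Lemma reJ z : re z^* = re z. Proof. by case: z. Qed.
Lemma imJ z : im z^* = - im z. Proof. by case: z. Qed.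
Lemma re_mkC a b : re (mkC a b) = a. Proof. by []. Qed.
Lemma im_mkC a b : im (mkC a b) = b. Proof. by []. Qed.
Lemma re0 : re (0 : CC R) = 0. Proof. by []. Qed.
Lemma im0 : im (0 : CC R) = 0. Proof. by []. Qed.
Lemma re1 : re (1 : CC R) = 1. Proof. by []. Qed.
Lemma im1 : im (1 : CC R) = 0. Proof. by []. Qed.

Definition reimE :=
  (reD, imD, reN, imN, reM, imM, reJ, imJ, re_mkC, im_mkC, re0, im0, re1, im1).

Definition realC t : CC R := mkC t 0.

Lemma realCD a b : realC (a + b) = realC a + realC b.
Proof. by apply: CC_ext; rewrite !reimE ?addr0. Qed.
Lemma realCN a : realC (- a) = - realC a.
Proof. by apply: CC_ext; rewrite !reimE ?oppr0. Qed.
Lemma realCM a b : realC (a * b) = realC a * realC b.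
Proof. by apply: CC_ext; rewrite !reimE; ring. Qed.
Lemma realC0 : realC 0 = 0. Proof. by []. Qed.
Lemma realC1 : realC 1 = 1. Proof. by []. Qed.
Lemma realC_nat k : realC k%:R = k%:R.
Proof. by elim: k => // k IH; rewrite -!natr1 realCD IH. Qed.
Lemma realC_eq0 a : (realC a == 0) = (a == 0).
Proof. by apply/eqP/eqP => [[]|->]. Qed.
Lemma norm_modC z : `|z| = realC (modC z).
Proof. by case: z. Qed.

Lemma modC_ge0 z : 0 <= modC z. Proof. by case: z => a b; exact: sqrtr_ge0. Qed.
Lemma modC0 : modC (0 : CC R) = 0. Proof. exact: ComplexField.Normc.normc0. Qed.
Lemma modC1 : modC (1 : CC R) = 1. Proof. exact: ComplexField.Normc.normc1. Qed.
Lemma modCM z w : modC (z * w) = modC z * modC w.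
Proof. exact: ComplexField.Normc.normcM. Qed.
Lemma modCV z : modC z^-1 = (modC z)^-1.
Proof. exact: ComplexField.Normc.normcV. Qed.
Lemma modCD z w : modC (z + w) <= modC z + modC w.
Proof. exact: le_normcD. Qed.
Lemma modCN z : modC (- z) = modC z. Proof. exact: normcN. Qed.
Lemma modCB z w : modC (z - w) <= modC z + modC w.
Proof. by rewrite -(modCN w); exact: modCD. Qed.
Lemma modC_sub z w : modC (z - w) = modC (w - z).
Proof. by rewrite -modCN opprB. Qed.
Lemma modC_eq0 z : (modC z == 0) = (z == 0).
Proof.
by apply/eqP/eqP => [|->]; [exact: ComplexField.Normc.eq0_normc|exact: modC0].
Qed.
Lemma modC_gt0 z : (0 < modC z) = (z != 0).
Proof. by rewrite lt_def modC_eq0 modC_ge0 andbT. Qed.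
Lemma modCX z k : modC (z ^+ k) = modC z ^+ k.
Proof. by elim: k => [|k IH]; rewrite ?modC1 // !exprS modCM IH. Qed.
Lemma modC_real a : modC (realC a) = `|a|.
Proof. by rewrite /modC /= expr0n addr0 sqrtr_sqr. Qed.
Lemma modC_nat k : modC (k%:R : CC R) = k%:R.
Proof. by rewrite -realC_nat modC_real ger0_norm. Qed.
Lemma modCJ z : modC z^* = modC z.
Proof. by case: z => a b; rewrite /modC /= sqrrN. Qed.

Lemma modC_sq z : modC z ^+ 2 = re z ^+ 2 + im z ^+ 2.
Proof. by case: z => a b; rewrite /modC /= sqr_sqrtr // addr_ge0 ?sqr_ge0. Qed.
Lemma mulCJ z : z * z^* = realC (modC z ^+ 2).
Proof. by rewrite modC_sq; apply: CC_ext; rewrite !reimE; ring. Qed.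
Lemma le_re_modC z : `|re z| <= modC z.
Proof.
rewrite -(@ler_pXn2r _ 2) ?nnegrE ?modC_ge0 // modC_sq real_normK ?num_real //.
by rewrite lerDl sqr_ge0.
Qed.
Lemma le_im_modC z : `|im z| <= modC z.
Proof.
rewrite -(@ler_pXn2r _ 2) ?nnegrE ?modC_ge0 // modC_sq real_normK ?num_real //.
by rewrite lerDr sqr_ge0.
Qed.
Lemma modC_le_reim z : modC z <= `|re z| + `|im z|.
Proof.
rewrite -(@ler_pXn2r _ 2) ?nnegrE ?modC_ge0 ?addr_ge0 // modC_sq sqrrD.
by rewrite !real_normK ?num_real // lerD2r lerDl mulrn_wge0 // mulr_ge0.
Qed.

Lemma modC_sum (I : Type) (s : seq I) (P : pred I) (F : I -> CC R) :
  modC (\sum_(i <- s | P i) F i) <= \sum_(i <- s | P i) modC (F i).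
Proof.
elim/big_rec2: _ => [|i y z _ h]; first by rewrite modC0.
by apply: le_trans (modCD _ _) _; rewrite lerD2l.
Qed.

Lemma modC_prod (I : Type) (s : seq I) (P : pred I) (F : I -> CC R) :
  modC (\prod_(i <- s | P i) F i) = \prod_(i <- s | P i) modC (F i).
Proof. by elim/big_rec2: _ => [|i y z _ h]; rewrite ?modC1 // modCM h. Qed.

Lemma re_sum (I : Type) (s : seq I) (P : pred I) (F : I -> CC R) :
  re (\sum_(i <- s | P i) F i) = \sum_(i <- s | P i) re (F i).
Proof. by elim/big_rec2: _ => [|i y z _ h]; rewrite ?re0 // reD h. Qed.

Lemma im_sum (I : Type) (s : seq I) (P : pred I) (F : I -> CC R) :
  im (\sum_(i <- s | P i) F i) = \sum_(i <- s | P i) im (F i).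
Proof. by elim/big_rec2: _ => [|i y z _ h]; rewrite ?im0 // imD h. Qed.

Lemma realC_prod (I : Type) (s : seq I) (P : pred I) (F : I -> R) :
  realC (\prod_(i <- s | P i) F i) = \prod_(i <- s | P i) realC (F i).
Proof. by elim/big_rec2: _ => [|i y z _ h]; rewrite ?realC1 // realCM h. Qed.
Lemma realCX a k : realC (a ^+ k) = realC a ^+ k.
Proof. by elim: k => // k IH; rewrite !exprS realCM IH. Qed.

End ComplexNumbers.

(** * Means *)

Section Means.
Variable R : realType.

(** Mass at most 1, rather than equal to 1, lets truncated geometric weights qualify. Linearity is
    asked of bounded functions only, since a limit along an ultrafilter is meaningful only for
    those. *)
Definition is_mean (I : Type) (l : (I -> R) -> R) : Prop :=
  [/\ forall u v, bounded_function u -> bounded_function v ->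
        l (fun i => u i + v i) = l u + l v,
      forall c u, bounded_function u -> l (fun i => c * u i) = c * l u,
      forall u, bounded_function u -> (forall i, 0 <= u i) -> 0 <= l u
    & l (fun=> 1) <= 1].

(* Finitely additive averages.  Being defined on all bounded functions, they
   replace integrals without any measurability to check. *)
Record mean (I : Type) := Mean { mean_fun :> (I -> R) -> R;
                                 mean_is_mean : is_mean mean_fun }.

Section MeanTheory.
Variables (I : Type) (l : mean I).

Lemma meanD u v : bounded_function u -> bounded_function v ->
  l (fun i => u i + v i) = l u + l v.
Proof. by case: (mean_is_mean l) => + _ _ _; apply. Qed.

Lemma meanZ c u : bounded_function u -> l (fun i => c * u i) = c * l u.
Proof. by case: (mean_is_mean l) => _ + _ _; apply. Qed.

Lemma mean_ge0 u : bounded_function u -> (forall i, 0 <= u i) -> 0 <= l u.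
Proof. by case: (mean_is_mean l) => _ _ + _; apply. Qed.

Lemma mean1_le1 : l (fun=> 1) <= 1.
Proof. by case: (mean_is_mean l). Qed.

End MeanTheory.

Lemma bounded_cst (I : Type) (c : R) : bounded_function (fun _ : I => c).
Proof. by exists `|c|. Qed.

Lemma boundedD (I : Type) (u v : I -> R) :
  bounded_function u -> bounded_function v ->
  bounded_function (fun i => u i + v i).
Proof.
move=> [B hB] [C hC]; exists (B + C) => i.
by apply: le_trans (ler_normD _ _) _; rewrite lerD.
Qed.

Lemma boundedZ (I : Type) (c : R) (u : I -> R) :
  bounded_function u -> bounded_function (fun i => c * u i).
Proof.
by move=> [B hB]; exists (`|c| * B) => i; rewrite normrM ler_wpM2l.
Qed.

Lemma mean_le (I : Type) (l : mean I) (u v : I -> R) :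
  bounded_function u -> bounded_function v -> (forall i, u i <= v i) ->
  l u <= l v.
Proof.
move=> bu bv uv; rewrite -subr_ge0 -mulN1r -meanZ // -meanD //.
  apply: mean_ge0 => [|i]; last by rewrite mulN1r subr_ge0.
  by apply: boundedD => //; exact: boundedZ.
exact: boundedZ.
Qed.

Lemma mean_abs_le (I : Type) (l : mean I) (u : I -> R) (B : R) :
  0 <= B -> (forall i, `|u i| <= B) -> `|l u| <= B.
Proof.
move=> B0 hu; have bu : bounded_function u by exists B.
have lB : l (fun=> B * 1) <= B.
  by rewrite meanZ; [exact: ler_piMr (mean1_le1 l)|exact: bounded_cst].
have bB : bounded_function (fun _ : I => B * 1) by exact: bounded_cst.
rewrite ler_norml; apply/andP; split.
  rewrite lerNl -mulN1r -meanZ //; apply: le_trans lB.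
  apply: mean_le => //; first exact: boundedZ.
  by move=> i; rewrite mulN1r mulr1 lerNl; have := hu i; rewrite ler_norml=> /andP[].
apply: le_trans lB; apply: mean_le => // i.
by rewrite mulr1; have := hu i; rewrite ler_norml=> /andP[].
Qed.

Definition cmean (I : Type) (l : mean I) (g : I -> CC R) : CC R :=
  mkC (l (re (R:=R) \o g)) (l (im (R:=R) \o g)).

Definition cbounded (I : Type) (g : I -> CC R) :=
  exists B, forall i, modC (g i) <= B.

Lemma cbounded_re (I : Type) (g : I -> CC R) :
  cbounded g -> bounded_function (re (R:=R) \o g).
Proof. by move=> [B h]; exists B => i; apply: le_trans (le_re_modC _) (h i). Qed.

Lemma cbounded_im (I : Type) (g : I -> CC R) :
  cbounded g -> bounded_function (im (R:=R) \o g).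
Proof. by move=> [B h]; exists B => i; apply: le_trans (le_im_modC _) (h i). Qed.

Lemma cboundedD (I : Type) (g h : I -> CC R) :
  cbounded g -> cbounded h -> cbounded (fun i => g i + h i).
Proof.
move=> [B hB] [C hC]; exists (B + C) => i.
by apply: le_trans (modCD _ _) _; rewrite lerD.
Qed.

Lemma cboundedM (I : Type) (g h : I -> CC R) :
  cbounded g -> cbounded h -> cbounded (fun i => g i * h i).
Proof.
move=> [B hB] [C hC]; exists (B * C) => i.
by rewrite modCM ler_pM ?modC_ge0.
Qed.

Lemma cbounded_cst (I : Type) c : cbounded (fun _ : I => c).
Proof. by exists (modC c). Qed.

Lemma cboundedZ (I : Type) c (g : I -> CC R) :
  cbounded g -> cbounded (fun i => c * g i).
Proof. by apply: cboundedM; exact: cbounded_cst. Qed.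

Lemma cboundedB (I : Type) (g h : I -> CC R) :
  cbounded g -> cbounded h -> cbounded (fun i => g i - h i).
Proof.
by move=> bg bh; apply: cboundedD => //; under eq_fun do rewrite -mulN1r;
  exact: cboundedZ.
Qed.

Lemma cboundedJ (I : Type) (g : I -> CC R) :
  cbounded g -> cbounded (fun i => (g i)^*).
Proof. by move=> [B hB]; exists B => i; rewrite modCJ. Qed.

Lemma cboundedX (I : Type) (g : I -> CC R) k :
  cbounded g -> cbounded (fun i => g i ^+ k).
Proof.
move=> bg; elim: k => [|k IH]; first exact: cbounded_cst.
by under eq_fun do rewrite exprS; exact: cboundedM.
Qed.

Lemma cbounded_prod (I K : Type) (s : seq K) (g : K -> I -> CC R) :
  (forall k, cbounded (g k)) -> cbounded (fun i => \prod_(k <- s) g k i).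
Proof.
move=> bg; elim: s => [|k s IH].
  by under eq_fun do rewrite big_nil; exact: cbounded_cst.
by under eq_fun do rewrite big_cons; exact: cboundedM.
Qed.

Lemma cbounded_sum (I K : Type) (s : seq K) (g : K -> I -> CC R) :
  (forall k, cbounded (g k)) -> cbounded (fun i => \sum_(k <- s) g k i).
Proof.
move=> bg; elim: s => [|k s IH].
  by under eq_fun do rewrite big_nil; exact: cbounded_cst.
by under eq_fun do rewrite big_cons; exact: cboundedD.
Qed.

Section Linearity.
Variables (I : Type) (l : mean I).

Lemma cmeanD g h : cbounded g -> cbounded h ->
  cmean l (fun i => g i + h i) = cmean l g + cmean l h.
Proof.
move=> bg bh; apply: CC_ext; rewrite !reimE -meanD;
  try (exact: cbounded_re || exact: cbounded_im);
  by congr (l _); apply/funext => i; rewrite /comp !reimE.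
Qed.

Lemma cmeanZ c g : cbounded g -> cmean l (fun i => c * g i) = c * cmean l g.
Proof.
move=> bg; have bR := cbounded_re bg; have bI := cbounded_im bg.
have E a b : l (fun i => a * re (g i) + b * im (g i)) =
    a * l (re (R:=R) \o g) + b * l (im (R:=R) \o g).
  by rewrite meanD ?meanZ //; exact: boundedZ.
apply: CC_ext; rewrite !reimE.
- rewrite -mulNr -E; congr (l _); apply/funext => i.
  by rewrite /comp !reimE mulNr.
- rewrite [RHS]addrC -E; congr (l _); apply/funext => i.
  by rewrite /comp !reimE addrC.
Qed.

Lemma cmeanN g : cbounded g -> cmean l (fun i => - g i) = - cmean l g.
Proof.
move=> bg; rewrite -mulN1r -cmeanZ //.
by congr (cmean l _); apply/funext => i; rewrite mulN1r.
Qed.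

Lemma cmeanB g h : cbounded g -> cbounded h ->
  cmean l (fun i => g i - h i) = cmean l g - cmean l h.
Proof.
move=> bg bh; rewrite -cmeanN // -cmeanD //.
by have := cboundedB (cbounded_cst I 0) bh; under eq_fun do rewrite sub0r.
Qed.

Lemma cmeanJ g : cbounded g -> cmean l (fun i => (g i)^*) = (cmean l g)^*.
Proof.
move=> bg; apply: CC_ext; rewrite !reimE.
- by congr (l _); apply/funext => i; rewrite /comp !reimE.
- rewrite -mulN1r -meanZ; last exact: cbounded_im.
  by congr (l _); apply/funext => i; rewrite /comp !reimE mulN1r.
Qed.

Lemma cmean_sum (K : Type) (s : seq K) (g : K -> I -> CC R) :
  (forall k, cbounded (g k)) ->
  cmean l (fun i => \sum_(k <- s) g k i) = \sum_(k <- s) cmean l (g k).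
Proof.
move=> bg; elim: s => [|k s IH].
  rewrite big_nil; under eq_fun do rewrite big_nil.
  rewrite -[RHS](mul0r (cmean l (fun=> 0))) -cmeanZ; last exact: cbounded_cst.
  by under [in RHS]eq_fun do rewrite mul0r.
rewrite big_cons -IH -cmeanD //; last exact: cbounded_sum.
by congr (cmean l _); apply/funext => i; rewrite big_cons.
Qed.

(** The factor 2 comes from estimating real and imaginary parts separately; it reappears in many
    constants below. *)
Lemma modC_cmean g B : (forall i, modC (g i) <= B) -> 0 <= B ->
  modC (cmean l g) <= 2 * B.
Proof.
move=> hg B0; apply: le_trans (modC_le_reim _) _; rewrite mulr_natl mulr2n.
by apply: lerD; apply: mean_abs_le => // i /=;
  [apply: le_trans (le_re_modC _) _|apply: le_trans (le_im_modC _) _].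
Qed.

End Linearity.

(** Iterated means, outer variable first, take the place of product measures: tori are built from
    circles in this way, and families of functions are averaged together with a torus. *)
Lemma bind_is_mean (I J : Type) (l : mean I) (m : I -> mean J) :
  is_mean (fun u : I * J -> R => l (fun i => m i (fun j => u (i, j)))).
Proof.
have bm (u : I * J -> R) : bounded_function u ->
    bounded_function (fun i => m i (fun j => u (i, j))) /\
    forall i, bounded_function (fun j => u (i, j)).
  move=> [B hB]; split=> [|i]; last by exists B.
  (* When [J] is empty nothing forces [B] to be nonnegative. *)
  exists `|B| => i; apply: mean_abs_le => // j.
  by apply: le_trans (hB _) (ler_norm _).
split.
- move=> u v bu bv; have [bu1 bu2] := bm _ bu; have [bv1 bv2] := bm _ bv.
  by rewrite -meanD //; congr (mean_fun l _); apply/funext => i; rewrite meanD.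
- move=> c u bu; have [bu1 bu2] := bm _ bu.
  by rewrite -meanZ //; congr (mean_fun l _); apply/funext => i; rewrite meanZ.
- move=> u bu u0; have [bu1 bu2] := bm _ bu.
  by apply: mean_ge0 => // i; exact: mean_ge0.
- apply: le_trans (_ : l (fun=> 1) <= _); last exact: mean1_le1.
  have [bu1 _] := bm _ (bounded_cst _ 1).
  by apply: mean_le => [//||i]; [exact: bounded_cst|exact: mean1_le1].
Qed.

Definition bind_mean (I J : Type) (l : mean I) (m : I -> mean J) :=
  Mean (bind_is_mean l m).

Lemma cmean_bind (I J : Type) (l : mean I) (m : I -> mean J) g :
  cmean (bind_mean l m) g = cmean l (fun i => cmean (m i) (fun j => g (i, j))).
Proof. by []. Qed.

Lemma map_is_mean (I J : Type) (l : mean I) (f : I -> J) :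
  is_mean (fun u : J -> R => l (u \o f)).
Proof.
have bf (u : J -> R) : bounded_function u -> bounded_function (u \o f).
  by move=> [B hB]; exists B => i; exact: hB.
split.
- by move=> u v bu bv; exact: meanD (bf _ bu) (bf _ bv).
- by move=> c u bu; exact: meanZ (bf _ bu).
- by move=> u bu u0; apply: mean_ge0 (bf _ bu) _ => i /=.
- exact: mean1_le1.
Qed.

Definition map_mean (I J : Type) (l : mean I) (f : I -> J) :=
  Mean (map_is_mean l f).

Lemma cmean_map (I J : Type) (l : mean I) (f : I -> J) g :
  cmean (map_mean l f) g = cmean l (g \o f).
Proof. by []. Qed.

Lemma dirac_is_mean (I : Type) (i : I) : is_mean (fun u : I -> R => u i).
Proof. by []. Qed.

Definition dirac_mean (I : Type) (i : I) := Mean (dirac_is_mean i).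

(* L is the limit along an ultrafilter on nat. *)
Lemma generalized_limit_exists : exists L : (nat -> R) -> R,
  [/\ forall u v, bounded_function u -> bounded_function v ->
        L (fun k => u k + v k) = L u + L v,
      forall c u, bounded_function u -> L (fun k => c * u k) = c * L u,
      forall u v, bounded_function u -> bounded_function v ->
        (exists N, forall k, (N <= k)%N -> u k <= v k) -> L u <= L v
    & L (fun=> 1) = 1].
Proof.
have [U [UU sU]] := ultraFilterLemma (@eventually_filter).
have cv (u : nat -> R) : bounded_function u -> cvg (u @ U).
  move=> [B hB].
  (* The values lie in the compact segment [-B, B], where every ultrafilter converges; it remains to
     see that the image of an ultrafilter is an ultrafilter. *)
  have := @segment_compact R (- B) B; rewrite compact_ultra => /(_ (u @ U)).
  have uUU : UltraFilter (u @ U).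
    split; first exact: fmap_proper_filter.
    move=> G GF sG; apply/seteqP; split => //= A GA.
    have [//|h] := in_ultra_setVsetC (u @^-1` A) UU.
    have GnA : G (~` A) by exact: sG.
    have G0 : G set0 by rewrite -(setICr A); exact: filterI.
    by case: (filter_not_empty G).
  move=> /(_ uUU) [].
    apply: sU; exists 0%N => // k _ /=.
    by rewrite in_itv /= -ler_norml.
  by move=> l [_ ul]; apply/cvg_ex; exists l.
exists (fun u => lim (u @ U)); split.
- by move=> u v bu bv; apply/cvg_lim => //; apply: cvgD; exact: cv.
- by move=> c u bu; apply/cvg_lim => //; apply: cvgMl_tmp; exact: cv.
- move=> u v bu bv [N hN].
  apply: (@ler_lim _ U _ _ u v (cv _ bu) (cv _ bv)).
  by apply: sU; exists N.
- exact: lim_cst.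
Qed.

Definition glim : (nat -> R) -> R := projT1 (cid generalized_limit_exists).

Lemma glimD u v : bounded_function u -> bounded_function v ->
  glim (fun k => u k + v k) = glim u + glim v.
Proof. by rewrite /glim; case: cid => L [+ _ _ _] /=; apply. Qed.

Lemma glimZ c u : bounded_function u -> glim (fun k => c * u k) = c * glim u.
Proof. by rewrite /glim; case: cid => L [_ + _ _] /=; apply. Qed.

Lemma glim_le u v : bounded_function u -> bounded_function v ->
  (exists N, forall k, (N <= k)%N -> u k <= v k) -> glim u <= glim v.
Proof. by rewrite /glim; case: cid => L [_ _ + _] /=; apply. Qed.

Lemma glim1 : glim (fun=> 1) = 1.
Proof. by rewrite /glim; case: cid => L []. Qed.

Lemma glim_cst c : glim (fun=> c) = c.
Proof.
by have := glimZ c (bounded_cst nat 1); rewrite glim1 mulr1.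
Qed.

Lemma glim0 u : bounded_function u ->
  (forall e, 0 < e -> exists N, forall k, (N <= k)%N -> `|u k| <= e) ->
  glim u = 0.
Proof.
move=> bu hu; apply/eqP; rewrite -normr_le0; apply/ler_addgt0Pr => e e0.
have [N hN] := hu e e0; rewrite add0r ler_norml; apply/andP; split.
- rewrite -[leLHS]glim_cst; apply: glim_le => //; first exact: bounded_cst.
  by exists N => k /hN; rewrite ler_norml => /andP[].
- rewrite -[leRHS]glim_cst; apply: glim_le => //; first exact: bounded_cst.
  by exists N => k /hN; rewrite ler_norml => /andP[].
Qed.

Lemma bounded_sum_weights (I : Type) (s : nat -> seq I) (w : nat -> I -> R)
    (u : I -> R) :
  (forall k i, 0 <= w k i) -> (forall k, \sum_(i <- s k) w k i <= 1) ->
  bounded_function u -> bounded_function (fun k => \sum_(i <- s k) w k i * u i).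
Proof.
move=> w0 w1 [B hB]; exists `|B| => k.
apply: le_trans (ler_norm_sum _ _ _) _.
apply: le_trans (_ : \sum_(i <- s k) w k i * `|B| <= _).
  apply: ler_sum => i _; rewrite normrM (ger0_norm (w0 _ _)) ler_wpM2l //.
  exact: le_trans (hB i) (ler_norm _).
by rewrite -mulr_suml ler_piMl.
Qed.

Section LimitMean.
Variables (I : Type) (s : nat -> seq I) (w : nat -> I -> R).
Hypothesis w0 : forall k i, 0 <= w k i.
Hypothesis w1 : forall k, \sum_(i <- s k) w k i <= 1.

(** Serves twice: for the circle, with equal weights on the 2^k-th roots of unity, and for the sum
    over the family, with geometric weights truncated after k terms. *)
Lemma limit_is_mean :
  is_mean (fun u => glim (fun k => \sum_(i <- s k) w k i * u i)).
Proof.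
have bw u (bu : bounded_function u) := bounded_sum_weights w0 w1 bu.
split.
- move=> u v bu bv; rewrite -glimD; [|exact: bw..].
  congr glim; apply/funext => k; rewrite -big_split.
  by apply: eq_bigr => i _; rewrite mulrDr.
- move=> c u bu; rewrite -glimZ; last exact: bw.
  congr glim; apply/funext => k; rewrite mulr_sumr.
  by apply: eq_bigr => i _; rewrite mulrCA.
- move=> u bu u0; rewrite -[leLHS]glim_cst; apply: glim_le.
  + exact: bounded_cst.
  + exact: bw.
  + by exists 0%N => k _; apply: sumr_ge0 => i _; rewrite mulr_ge0.
- rewrite -[leRHS]glim1; apply: glim_le.
  + by apply: bw; exact: bounded_cst.
  + exact: bounded_cst.
  + by exists 0%N => k _; under eq_bigr do rewrite mulr1.
Qed.

Definition limit_mean := Mean limit_is_mean.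

End LimitMean.

End Means.

(** * Goursat's theorem *)

Section Goursat.
Variable R : realType.
Implicit Types (u v c : R -> CC R) (U V C : R -> R -> CC R).

Definition cderive_at (F : CC R -> CC R) (w D : CC R) := forall e, 0 < e ->
  exists2 d, 0 < d & forall z, modC (z - w) < d ->
    modC (F z - F w - D * (z - w)) <= e * modC (z - w).

Definition cdiff_at F w := exists D, cderive_at F w D.

(* Trapezoid sums, with 2^k steps, for the integral of [u dc] over [a, b]: they
   are exact when u is an affine function of c. *)
Fixpoint trap k u c (a b : R) : CC R :=
  if k is k'.+1 then trap k' u c a ((a + b) / 2) + trap k' u c ((a + b) / 2) b
  else (u a + u b) / 2 * (c b - c a).

Lemma trapD k u v c a b :
  trap k (fun t => u t + v t) c a b = trap k u c a b + trap k v c a b.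
Proof.
elim: k a b => [|k IH] a b /=; first by rewrite -mulrDl -mulrDl addrACA.
by rewrite !IH addrACA.
Qed.

(** On one step the trapezoid value of c dc is (c(b)^2 - c(a)^2) / 2, which telescopes. Hence
    trapezoid sums, unlike one-sided Riemann sums, vanish exactly on closed loops. *)
Lemma trap_affine k (al be : CC R) c a b :
  trap k (fun t => al + be * c t) c a b =
  al * (c b - c a) + be / 2 * (c b ^+ 2 - c a ^+ 2).
Proof.
elim: k a b => [|k IH] a b /=; first by field.
by rewrite !IH; ring.
Qed.

Lemma trap_le k u c a b (B L : R) : a <= b -> 0 <= B ->
  (forall t, a <= t <= b -> modC (u t) <= B) ->
  (forall s t, a <= s -> s <= t -> t <= b -> modC (c t - c s) <= L * (t - s)) ->
  modC (trap k u c a b) <= B * (L * (b - a)).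
Proof.
move=> + B0; elim: k a b => [|k IH] a b ab hu hc /=.
  rewrite !modCM ler_pM ?mulr_ge0 ?modC_ge0 //; last exact: hc.
  rewrite modCV modC_nat ler_pdivrMr // mulrC mulr_natl mulr2n.
  by apply: le_trans (modCD _ _) _; apply: lerD; apply: hu; rewrite ?lexx ?ab.
apply: le_trans (modCD _ _) _.
have -> : B * (L * (b - a)) =
    B * (L * ((a + b) / 2 - a)) + B * (L * (b - (a + b) / 2)) by field.
apply: lerD; apply: IH; try lra.
- by move=> t /andP[? ?]; apply: hu; apply/andP; split; lra.
- by move=> s t ? ? ?; apply: hc; lra.
- by move=> t /andP[? ?]; apply: hu; apply/andP; split; lra.
- by move=> s t ? ? ?; apply: hc; lra.
Qed.

Definition bdry k U C x y s :=
  trap k (U ^~ y) (C ^~ y) x (x + s) + trap k (U (x + s)) (C (x + s)) y (y + s)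
  - trap k (U ^~ (y + s)) (C ^~ (y + s)) x (x + s)
  - trap k (U x) (C x) y (y + s).

(** The inner edges cancel exactly, not only in the limit, because 2^(k+1) steps on a side are 2^k
    steps on each of its halves. *)
Lemma bdry_split k U C x y s : bdry k.+1 U C x y s =
  bdry k U C x y (s / 2) + bdry k U C (x + s / 2) y (s / 2)
  + bdry k U C x (y + s / 2) (s / 2) + bdry k U C (x + s / 2) (y + s / 2) (s / 2).
Proof.
have E z : (z + (z + s)) / 2 = z + s / 2 by field.
have H z : z + s / 2 + s / 2 = z + s by field.
by rewrite /bdry /= !E !H; ring.
Qed.

Lemma bdryD k U V C x y s :
  bdry k (fun p q => U p q + V p q) C x y s = bdry k U C x y s + bdry k V C x y s.
Proof. by rewrite /bdry !trapD; ring. Qed.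

Lemma bdry_affine k (al be : CC R) C x y s :
  bdry k (fun p q => al + be * C p q) C x y s = 0.
Proof. by rewrite /bdry !trap_affine; ring. Qed.

Lemma half_power_lt (d : R) : 0 < d -> exists n, (2^-1 : R) ^+ n < d.
Proof.
move=> d0; exists (Num.bound d^-1); rewrite exprVn invf_plt ?posrE ?exprn_gt0 //.
apply: lt_trans (archi_boundP _) _; first by rewrite invr_ge0 ltW.
by rewrite -natrX ltr_nat ltn_expl.
Qed.

Lemma nested_point (a b : nat -> R) :
  (forall n, a n <= a n.+1) -> (forall n, b n.+1 <= b n) ->
  (forall n, a n <= b n) -> exists x, forall n, a n <= x <= b n.
Proof.
move=> ha hb hab.
have hA n m : a n <= a (n + m)%N.
  by elim: m => [|m IH]; rewrite ?addn0 // addnS (le_trans IH).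
have hB n m : b (n + m)%N <= b n.
  by elim: m => [|m IH]; rewrite ?addn0 // addnS (le_trans (hb _)).
have hAB m n : a m <= b n.
  by apply: le_trans (hA m n) (le_trans (hab _) _); rewrite addnC.
have ub n : ubound (range a) (b n) by move=> _ [m _ <-].
exists (sup (range a)) => n; apply/andP; split.
- by apply: ub_le_sup; [exists (b 0%N)|exists n].
- by apply: ge_sup => //; exists (a 0%N), 0%N.
Qed.

(** A square where [P] fails has a quarter where [P] fails; the nested failing squares shrink to a
    point, at which the local hypothesis contradicts failure. *)
Lemma square_bisection (P : R -> R -> R -> Prop) :
  (forall x y s, P x y (s / 2) -> P (x + s / 2) y (s / 2) ->
    P x (y + s / 2) (s / 2) -> P (x + s / 2) (y + s / 2) (s / 2) -> P x y s) ->
  (forall x y, 0 <= x <= 1 -> 0 <= y <= 1 -> exists2 d, 0 < d &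
    forall a b s, 0 < s < d -> 0 <= a -> a + s <= 1 -> 0 <= b -> b + s <= 1 ->
      a <= x <= a + s -> b <= y <= b + s -> P a b s) ->
  P 0 0 1.
Proof.
move=> hsplit hloc; apply: contrapT => nP.
pose Q (t : R * R * R) := P t.1.1 t.1.2 t.2.
(* Stated for every triple, with failure as an implication, so that choice yields a function that
   can be iterated. *)
have step t : exists t', [/\ ~ Q t -> ~ Q t', t'.2 = t.2 / 2,
    t'.1.1 = t.1.1 \/ t'.1.1 = t.1.1 + t.2 / 2
  & t'.1.2 = t.1.2 \/ t'.1.2 = t.1.2 + t.2 / 2].
  case: t => [[x y] s].
  have [h1|h1] := pselect (P x y (s / 2)); last first.
    by exists (x, y, s / 2); split => //=; left.
  have [h2|h2] := pselect (P (x + s / 2) y (s / 2)); last first.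
    by exists (x + s / 2, y, s / 2); split => //=; [right|left].
  have [h3|h3] := pselect (P x (y + s / 2) (s / 2)); last first.
    by exists (x, y + s / 2, s / 2); split => //=; [left|right].
  exists (x + s / 2, y + s / 2, s / 2); split => //=; try by right.
  by rewrite /Q /= => h h4; apply: h; exact: hsplit.
have [f hf] := choice step.
pose q n := iter n f (0, 0, 1).
have nQ n : ~ Q (q n) by elim: n => [//|n IH] /=; case: (hf (q n)) => + _ _ _; apply.
have qs n : (q n).2 = 2^-1 ^+ n.
  by elim: n => [//|n IH]; case: (hf (q n)) => _ + _ _ /=; rewrite IH exprSr.
have s0 n : 0 < (q n).2 by rewrite qs exprn_gt0.
have [x hx] : exists x, forall n, (q n).1.1 <= x <= (q n).1.1 + (q n).2.
  apply: nested_point => n; last by rewrite lerDl ltW.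
  - by have := s0 n; case: (hf (q n)) => _ _ + _ /=; case=> ->; lra.
  - by have := s0 n; case: (hf (q n)) => _ + + _ /=; move=> -> [] ->; lra.
have [y hy] : exists y, forall n, (q n).1.2 <= y <= (q n).1.2 + (q n).2.
  apply: nested_point => n; last by rewrite lerDl ltW.
  - by have := s0 n; case: (hf (q n)) => _ _ _ /=; case=> ->; lra.
  - by have := s0 n; case: (hf (q n)) => _ + _ /=; move=> -> [] ->; lra.
have box n : [/\ 0 <= (q n).1.1, (q n).1.1 + (q n).2 <= 1, 0 <= (q n).1.2
                & (q n).1.2 + (q n).2 <= 1].
  elim: n => [|n [h1 h2 h3 h4]]; first by split => //=; lra.
  have := s0 n; case: (hf (q n)) => _ /= -> + + ?.
  by case=> ->; case=> ->; split; lra.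
have := hx 0%N; rewrite /= add0r => x01.
have := hy 0%N; rewrite /= add0r => y01.
have [d d0 hd] := hloc x y x01 y01.
have [n hn] := half_power_lt d0.
have [h1 h2 h3 h4] := box n.
by apply: (nQ n); apply: hd => //; rewrite s0 qs.
Qed.

Section Square.
Variables (G : CC R -> CC R) (C : R -> R -> CC R) (L : R).
Hypothesis hx : forall y s t : R, 0 <= y <= 1 -> 0 <= s -> s <= t -> t <= 1 ->
  modC (C t y - C s y) <= L * (t - s).
Hypothesis hy : forall x s t : R, 0 <= x <= 1 -> 0 <= s -> s <= t -> t <= 1 ->
  modC (C x t - C x s) <= L * (t - s).
Hypothesis hG : forall x y : R, 0 <= x <= 1 -> 0 <= y <= 1 -> cdiff_at G (C x y).

Let dist_x (y s t : R) : 0 <= y <= 1 -> 0 <= s <= 1 -> 0 <= t <= 1 ->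
  modC (C t y - C s y) <= L * `|t - s|.
Proof.
move=> y01 /andP[s0 s1] /andP[t0 t1]; have [st|/ltW ts] := leP s t.
  by rewrite ger0_norm ?subr_ge0 //; exact: hx.
by rewrite modC_sub distrC ger0_norm ?subr_ge0 //; exact: hx.
Qed.

Let dist_y (x s t : R) : 0 <= x <= 1 -> 0 <= s <= 1 -> 0 <= t <= 1 ->
  modC (C x t - C x s) <= L * `|t - s|.
Proof.
move=> x01 /andP[s0 s1] /andP[t0 t1]; have [st|/ltW ts] := leP s t.
  by rewrite ger0_norm ?subr_ge0 //; exact: hy.
by rewrite modC_sub distrC ger0_norm ?subr_ge0 //; exact: hy.
Qed.

Lemma goursat_square (e : R) : 0 < e -> exists K, forall k, (K <= k)%N ->
  modC (bdry k (fun x y => G (C x y)) C 0 0 1) <= e.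
Proof.
move=> e0.
have L0 : 0 <= L.
  have := @hx 0 0 1; rewrite !subr0 mulr1 !lexx ler01 /= => h.
  have {}h := h isT isT isT isT. exact: le_trans (modC_ge0 _) h.
(* The tolerance is proportional to the area, so the tolerances of four quarters add up to that of
   the square. *)
pose P x y s := exists K, forall k, (K <= k)%N ->
  modC (bdry k (fun x y => G (C x y)) C x y s) <= e * s ^+ 2.
suff [K hK] : P 0 0 1 by exists K => k /hK; rewrite expr1n mulr1.
apply: square_bisection.
  move=> x y s [K1 h1] [K2 h2] [K3 h3] [K4 h4].
  exists (maxn (maxn K1 K2) (maxn K3 K4)).+1 => -[//|k].
  rewrite ltnS !geq_max => /andP[/andP[/h1 l1 /h2 l2] /andP[/h3 l3 /h4 l4]].
  rewrite bdry_split.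
  have -> : e * s ^+ 2 = e * (s / 2) ^+ 2 + e * (s / 2) ^+ 2 + e * (s / 2) ^+ 2
    + e * (s / 2) ^+ 2 by field.
  by do 3 (apply: le_trans (modCD _ _) _; apply: lerD => //).
move=> x y x01 y01; have [D hD] := hG x01 y01.
have L2 : 0 <= L ^+ 2 by rewrite sqr_ge0.
(* Each of the four sides will contribute at most eta (2 L s)(L s), in total 8 eta L^2 s^2; the
   added 1 covers L = 0. *)
pose eta := e / (8 * L ^+ 2 + 1).
have eta0 : 0 < eta by rewrite divr_gt0 //; lra.
have [d d0 hd] := hD eta eta0.
have dL : 0 < d / (2 * L + 1) by rewrite divr_gt0 //; lra.
exists (d / (2 * L + 1)) => // a b s /andP[s0 sd] a0 a1 b0 b1 ax bY.
have {}sd : 2 * L * s < d by move: sd; rewrite ltr_pdivlMr; lra.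
exists 0%N => k _.
pose E p q := G (C p q) - G (C x y) - D * (C p q - C x y).
have hE p q : a <= p <= a + s -> b <= q <= b + s ->
    modC (E p q) <= eta * (2 * L * s).
  move=> /andP[p1 p2] /andP[q1 q2].
  have dist : modC (C p q - C x y) <= 2 * L * s.
    have -> : C p q - C x y = (C p q - C x q) + (C x q - C x y) by ring.
    apply: le_trans (modCD _ _) _.
    have -> : 2 * L * s = L * s + L * s by ring.
    case/andP: ax bY => ? ? /andP[? ?].
    apply: lerD.
      apply: le_trans (dist_x _ _ _) _; rewrite ?x01 //; try (apply/andP; split; lra).
      by rewrite ler_wpM2l // ler_norml; apply/andP; split; lra.
    apply: le_trans (dist_y _ _ _) _; rewrite ?y01 //; try (apply/andP; split; lra).
    by rewrite ler_wpM2l // ler_norml; apply/andP; split; lra.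
  apply: le_trans (hd _ _) _; first exact: le_lt_trans dist sd.
  by rewrite ler_wpM2l // ltW.
(* The affine part of G has boundary sum zero for every k; only the error E is left to estimate. *)
have -> : (fun p q => G (C p q)) =
    (fun p q => ((G (C x y) - D * C x y) + D * C p q) + E p q).
  by apply/funext => p; apply/funext => q; rewrite /E; ring.
rewrite bdryD bdry_affine add0r.
set B := eta * (2 * L * s) in hE.
have B0 : 0 <= B by rewrite /B mulr_ge0 ?(ltW eta0) ?mulr_ge0 ?(ltW s0).
have bx q : b <= q <= b + s ->
    modC (trap k (E ^~ q) (C ^~ q) a (a + s)) <= B * (L * s).
  move=> /andP[q1 q2].
  have -> : L * s = L * (a + s - a) by ring.
  apply: trap_le; rewrite ?lerDl ?(ltW s0) //.
  - by move=> p hp; apply: hE => //; rewrite q1.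
  - by move=> p p' *; apply: hx; try (apply/andP; split); lra.
have bb p : a <= p <= a + s ->
    modC (trap k (E p) (C p) b (b + s)) <= B * (L * s).
  move=> /andP[p1 p2].
  have -> : L * s = L * (b + s - b) by ring.
  apply: trap_le; rewrite ?lerDl ?(ltW s0) //.
  - by move=> q hq; apply: hE => //; rewrite p1.
  - by move=> q q' *; apply: hy; try (apply/andP; split); lra.
apply: le_trans (_ : 4 * (B * (L * s)) <= _).
  have -> : 4 * (B * (L * s)) = B * (L * s) + B * (L * s) + B * (L * s) + B * (L * s).
    by ring.
  rewrite /bdry; apply: le_trans (modCB _ _) _; apply: lerD; last first.
    by apply: bb; apply/andP; split; lra.
  apply: le_trans (modCB _ _) _; apply: lerD; last first.
    by apply: bx; apply/andP; split; lra.
  apply: le_trans (modCD _ _) _; apply: lerD.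
    by apply: bx; apply/andP; split; lra.
  by apply: bb; apply/andP; split; lra.
have -> : 4 * (B * (L * s)) = eta * (8 * L ^+ 2) * s ^+ 2 by rewrite /B; ring.
rewrite ler_wpM2r ?sqr_ge0 // /eta mulrAC ler_pdivrMr; last by lra.
by rewrite ler_wpM2l ?ltW //; lra.
Qed.

End Square.
End Goursat.

(** * Cauchy's formula on a circle *)

Section Circle.
Variable R : realType.
Implicit Types (F G : CC R -> CC R) (u c : R -> CC R) (r t : R) (z w : CC R).

Definition cis t : CC R := mkC (cos t) (sin t).

Lemma cis0 : cis 0 = 1. Proof. by apply: CC_ext; rewrite !reimE ?cos0 ?sin0. Qed.
Lemma cisD s t : cis (s + t) = cis s * cis t.
Proof. by apply: CC_ext; rewrite !reimE ?cosD ?sinD //; ring. Qed.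
Lemma cisX t k : cis t ^+ k = cis (k%:R * t).
Proof.
by elim: k => [|k IH]; rewrite ?mul0r ?cis0 // exprSr IH -cisD -natr1 mulrDl mul1r.
Qed.
Lemma cis2pi : cis (2 * pi) = 1.
Proof.
by apply: CC_ext; rewrite !reimE mulr_natl ?cos2pi ?sin2pi.
Qed.
Lemma cispi : cis pi = -1.
Proof. by apply: CC_ext; rewrite !reimE ?cospi ?sinpi ?oppr0. Qed.
Lemma modC_cis t : modC (cis t) = 1.
Proof. by apply/eqP; rewrite -sqrp_eq1 ?modC_ge0 // modC_sq cos2Dsin2. Qed.
Lemma cis_neq0 t : cis t != 0.
Proof. by rewrite -modC_gt0 modC_cis. Qed.

Lemma cis_lipschitz s t : s <= t -> modC (cis t - cis s) <= 2 * (t - s).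
Proof.
move=> st; apply: le_trans (modC_le_reim _) _; rewrite !reimE mulr_natl mulr2n.
apply: lerD.
- have [|x _ ->] := @MVT_segment R cos (fun x => - sin x) s t st.
    by apply: continuous_subspaceT => x; exact: continuous_cos.
  rewrite normrM (ger0_norm (_ : 0 <= t - s)) ?subr_ge0 // normrN.
  by rewrite ler_piMl ?subr_ge0 // ler_norml sin_geN1 sin_le1.
- have [|x _ ->] := @MVT_segment R sin cos s t st.
    by apply: continuous_subspaceT => x; exact: continuous_sin.
  rewrite normrM (ger0_norm (_ : 0 <= t - s)) ?subr_ge0 //.
  by rewrite ler_piMl ?subr_ge0 // ler_norml cos_geN1 cos_le1.
Qed.

Definition circ r t : CC R := realC r * cis t.

Lemma modC_circ r t : 0 < r -> modC (circ r t) = r.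
Proof. by move=> r0; rewrite modCM modC_cis modC_real mulr1 gtr0_norm. Qed.

Lemma circ_neq0 r t : 0 < r -> circ r t != 0.
Proof. by move=> r0; rewrite -modC_gt0 modC_circ. Qed.

Lemma cdiff_cst (a w : CC R) : cdiff_at (fun=> a) w.
Proof.
exists 0 => e e0; exists 1 => // z _.
by rewrite subrr mul0r subrr modC0 mulr_ge0 ?modC_ge0 // ltW.
Qed.

(** Covers both the difference quotient of Cauchy's formula, with a = F p, and the function 1 / (1 -
    b w), which is (0 - 1/b) / (w - 1/b). *)
Lemma cdiff_quot F a p w : w != p -> cdiff_at F w ->
  cdiff_at (fun z => (F z - a) / (z - p)) w.
Proof.
move=> wp [D hD]; set d := w - p; have d0 : d != 0 by rewrite subr_eq0.
have md0 : 0 < modC d by rewrite modC_gt0.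
set N := F w - a; pose D' := D / d - N / d ^+ 2; exists D' => e e0.
have K0 : 0 <= modC (D' / d) by exact: modC_ge0.
have e1 : 0 < e * modC d / 4 by rewrite divr_gt0 // mulr_gt0.
have [eta eta0 heta] := hD _ e1.
have e2 : 0 < e / (4 * (modC (D' / d) + 1)) by rewrite divr_gt0 // mulr_gt0 // ltr_wpDl.
exists (Order.min eta (Order.min (modC d / 2) (e / (4 * (modC (D' / d) + 1))))).
  by rewrite !lt_min eta0 e2 divr_gt0.
move=> z; rewrite !lt_min => /and3P[/heta hE zd zK].
set x := z - w in hE zd zK *; set E := F z - F w - D * x in hE.
have zp : z - p = d + x by rewrite /d /x; ring.
have mdx : modC d / 2 <= modC (d + x).
  have : modC d <= modC (d + x) + modC x.
    by rewrite -{1}(addrK x d); exact: modCB.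
  by move: zd; lra.
have dx0 : d + x != 0.
  by rewrite -modC_gt0; apply: lt_le_trans mdx; rewrite divr_gt0.
have Fz : F z - a = N + D * x + E by rewrite /N /E; ring.
(* The error is an exact quotient whose denominator has modulus at least |d| / 2. *)
have -> : (F z - a) / (z - p) - (F w - a) / (w - p) - D' * x =
    (E - D' * x ^+ 2) / (d + x).
  rewrite zp Fz -/N -/d /D'; field; by rewrite dx0 d0.
rewrite modCM modCV ler_pdivrMr ?modC_gt0 //.
apply: le_trans (_ : e * modC x * (modC d / 2) <= _); last first.
  by rewrite ler_wpM2l // mulr_ge0 ?modC_ge0 // ltW.
apply: le_trans (modCB _ _) _.
have -> : D' * x ^+ 2 = (D' / d) * d * x ^+ 2 by field.
rewrite expr2 !modCM.
have : modC (D' / d) * modC x <= e / 4.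
  have -> : e / 4 = (modC (D' / d) + 1) * (e / (4 * (modC (D' / d) + 1))).
    by field; rewrite gt_eqF // ltr_wpDl.
  by apply: ler_pM; rewrite ?modC_ge0 ?lerDl // ltW.
rewrite modCM => hK.
have -> : e * modC x * (modC d / 2) =
   e * modC d / 4 * modC x + e / 4 * (modC d * modC x) by field.
apply: lerD => //.
have -> : modC D' * modC d^-1 * modC d * (modC x * modC x) =
   modC D' * modC d^-1 * modC x * (modC d * modC x) by ring.
by rewrite ler_wpM2r // mulr_ge0 ?modC_ge0.
Qed.

Lemma trap_sumE k u c a b : trap k u c a b =
  \sum_(0 <= l < 2 ^ k)
    (u (a + (b - a) * (l%:R / 2 ^+ k)) + u (a + (b - a) * (l.+1%:R / 2 ^+ k))) / 2
    * (c (a + (b - a) * (l.+1%:R / 2 ^+ k)) - c (a + (b - a) * (l%:R / 2 ^+ k))).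
Proof.
elim: k a b => [|k IH] a b.
  rewrite big_nat1 /= expr0 !divr1 mulr0 mulr1 addr0.
  by have -> : a + (b - a) = b by ring.
have p0 : (2 ^+ k : R) != 0 by rewrite expf_neq0.
rewrite expnS mul2n -addnn (big_cat_nat (n := (2 ^ k)%N)) ?leq_addr //=.
have shift (H : nat -> CC R) N :
    \sum_(N <= l < N + N) H l = \sum_(0 <= l < N) H (l + N)%N.
  by rewrite -{1}(add0n N) big_addn addnK.
rewrite shift !IH; congr (_ + _).
  apply: eq_big_nat => l _.
  have E m : a + ((a + b) / 2 - a) * (m%:R / 2 ^+ k) =
     a + (b - a) * (m%:R / 2 ^+ k.+1) by rewrite exprS; field.
  by rewrite !E.
apply: eq_big_nat => l _.
have E m : (a + b) / 2 + (b - (a + b) / 2) * (m%:R / 2 ^+ k) =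
     a + (b - a) * ((m + 2 ^ k)%:R / 2 ^+ k.+1).
  by rewrite exprS natrD natrX; field.
by rewrite !E addSn.
Qed.

End Circle.

Section CauchyFormula.
Variable R : realType.
Implicit Types (F G : CC R -> CC R) (r t : R) (z w : CC R).

Definition root_angle k l : R := 2 * pi * (l%:R / 2 ^+ k).

Lemma sum_root_weights k :
  \sum_(t <- [seq root_angle k l | l <- index_iota 0 (2 ^ k)]) (2 ^- k : R) = 1.
Proof.
by rewrite big_map sumr_const_nat subn0 -[LHS]mulr_natr natrX mulVf ?expf_neq0.
Qed.

Let root_weight_ge0 k (t : R) : 0 <= (2 ^- k : R).
Proof. by rewrite invr_ge0 exprn_ge0. Qed.

Let root_weight_le1 k :
  \sum_(t <- [seq root_angle k l | l <- index_iota 0 (2 ^ k)]) (2 ^- k : R) <= 1.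
Proof. by rewrite sum_root_weights. Qed.

(* The limit of the averages over the 2^k-th roots of unity. *)
Definition circle_mean : mean R R := limit_mean root_weight_ge0 root_weight_le1.

Lemma circle_mean1 : circle_mean (fun=> 1) = 1.
Proof.
rewrite -[RHS]glim1 /=; congr glim; apply/funext => k.
by under eq_bigr do rewrite mulr1; exact: sum_root_weights.
Qed.

Lemma cmean_circle_cst (a : CC R) : cmean circle_mean (fun=> a) = a.
Proof.
rewrite -[in LHS](mulr1 a) cmeanZ; last exact: cbounded_cst.
suff -> : cmean circle_mean (fun=> 1) = 1 by rewrite mulr1.
apply: CC_ext; rewrite reimE; first exact: circle_mean1.
rewrite -[RHS](mul0r (circle_mean (fun=> 0))) -meanZ; last exact: bounded_cst.
by congr (mean_fun _ _); apply/funext => t; rewrite /= mul0r.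
Qed.

Lemma cmean_circle0 (g : R -> CC R) : cbounded g ->
  (forall e, 0 < e -> exists K, forall k, (K <= k)%N ->
    modC (\sum_(0 <= l < 2 ^ k) g (root_angle k l)) <= e * 2 ^+ k) ->
  cmean circle_mean g = 0.
Proof.
move=> bg hg.
have E (p : CC R -> R) (pS : forall k, p (\sum_(0 <= l < 2 ^ k) g (root_angle k l)) =
      \sum_(0 <= l < 2 ^ k) p (g (root_angle k l))) (bp : bounded_function (p \o g)) :
    (forall z, `|p z| <= modC z) -> circle_mean (p \o g) = 0.
  move=> pz; apply: glim0.
    by apply: bounded_sum_weights => // k; rewrite sum_root_weights.
  move=> e e0; have [K hK] := hg e e0; exists K => k /hK.
  rewrite -mulr_sumr big_map -pS normrM ger0_norm ?invr_ge0 ?exprn_ge0 // => h.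
  rewrite mulrC ler_pdivrMr ?exprn_gt0 //; exact: le_trans (pz _) h.
apply: CC_ext; rewrite !reimE.
- apply: E; [by move=> k; rewrite re_sum|exact: cbounded_re|exact: le_re_modC].
- apply: E; [by move=> k; rewrite im_sum|exact: cbounded_im|exact: le_im_modC].
Qed.

Lemma root_angleS k l : cis (root_angle k l.+1) = cis (root_angle k 1) * cis (root_angle k l).
Proof. by rewrite -cisD /root_angle -natr1; congr cis; ring. Qed.

Lemma modC_expr_sub1 z k : modC z <= 1 -> modC (z ^+ k - 1) <= k%:R * modC (z - 1).
Proof.
move=> z1; rewrite subrX1 modCM mulrC ler_wpM2r ?modC_ge0 //.
apply: le_trans (modC_sum _ _ _) _; rewrite -[k in k%:R]card_ord -sumr_const.
by apply: ler_sum => i _; rewrite modCX exprn_ile1 ?modC_ge0.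
Qed.

(** With q the square of the 2^(k+2)-th root, q^(2^k) = -1, so 2 = |q^(2^k) - 1| <= 2^k |q - 1|.
    This gives the size of the gap between roots without asymptotics of the sine. *)
Lemma root_gap k : 8 <= 2 ^+ k.+2 * modC (cis (root_angle k.+2 1) ^+ 2 - 1).
Proof.
set q := cis _ ^+ 2.
have q1 : modC q <= 1 by rewrite modCX modC_cis expr1n.
have qE : q ^+ (2 ^ k) = -1.
  rewrite -cispi -exprM cisX; congr cis; rewrite /root_angle natrM natrX !exprS.
  by field; rewrite expf_neq0.
have := modC_expr_sub1 (2 ^ k) q1; rewrite qE natrX -opprD modCN.
by rewrite -[1 + 1]/(2%:R) modC_nat !exprS; lra.
Qed.

Lemma modC_kernel z w r : 0 < r -> modC w = r -> modC z < r ->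
  modC (1 / (1 - z / w)) <= 1 / (1 - modC z / r).
Proof.
move=> r0 wr zr; have q1 : modC z / r < 1 by rewrite ltr_pdivrMr ?mul1r.
rewrite !div1r modCV lef_pV2 ?posrE ?subr_gt0 //; last first.
  rewrite modC_gt0 subr_eq0; apply/negP => /eqP /(congr1 (@modC R)).
  by rewrite modC1 modCM modCV wr => h; move: q1; rewrite -h ltxx.
rewrite lerBlDr -{1}modC1 -{1}(subrK (z / w) 1).
by rewrite (le_trans (modCD _ _)) // modCM modCV wr.
Qed.

Lemma cbounded_kernel z r : 0 < r -> modC z < r ->
  cbounded (fun t => 1 / (1 - z / circ r t)).
Proof.
move=> r0 zr; exists (1 / (1 - modC z / r)) => t.
by rewrite modC_kernel // modC_circ.
Qed.

Lemma modC_convex r t z w : 0 <= t <= 1 -> modC z <= r -> modC w <= r ->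
  modC (z + realC t * (w - z)) <= r.
Proof.
move=> /andP[t0 t1] zr wr.
have -> : z + realC t * (w - z) = realC (1 - t) * z + realC t * w.
  by rewrite realCD realCN realC1; ring.
apply: le_trans (modCD _ _) _; rewrite !modCM !modC_real !ger0_norm ?subr_ge0 //.
have -> : r = (1 - t) * r + t * r by ring.
by apply: lerD; rewrite ler_wpM2l ?subr_ge0.
Qed.

Section Formula.
Variables (F : CC R -> CC R) (r : R) (z : CC R) (B : R).
Hypothesis zr : modC z < r.
Hypothesis F_cdiff : forall w, modC w <= r -> cdiff_at F w.
Hypothesis F_bounded : forall w, modC w <= r -> modC (F w) <= B.

Let r0 : 0 < r. Proof. exact: le_lt_trans (modC_ge0 _) zr. Qed.
Let B0 : 0 <= B. Proof. exact: le_trans (modC_ge0 _) (F_bounded (ltW zr)). Qed.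
Let G w := (F w - F z) / (w - z).

(** Near z the quotient is controlled by the derivative, and at distance at least d from z by 2 B /
    d. *)
Let G_bounded : exists2 M, 0 <= M & forall w, modC w <= r -> modC (G w) <= M.
Proof.
have [D hD] := F_cdiff (ltW zr); have [d d0 hd] := hD 1 ltr01.
exists (modC D + 1 + 2 * B / d).
  by rewrite !addr_ge0 ?modC_ge0 // divr_ge0 ?mulr_ge0 // ltW.
move=> w wr; have [->|wz] := eqVneq w z.
  rewrite /G !subrr mul0r modC0.
  by rewrite !addr_ge0 ?modC_ge0 // divr_ge0 ?mulr_ge0 // ltW.
have wz0 : 0 < modC (w - z) by rewrite modC_gt0 subr_eq0.
rewrite /G modCM modCV ler_pdivrMr //.
have [wd|dw] := ltP (modC (w - z)) d.
  have := hd w wd; rewrite mul1r => h.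
  have -> : F w - F z = (F w - F z - D * (w - z)) + D * (w - z) by ring.
  apply: le_trans (modCD _ _) _; rewrite modCM.
  apply: le_trans (_ : (modC D + 1) * modC (w - z) <= _); last first.
    by rewrite ler_wpM2r ?modC_ge0 // lerDl divr_ge0 ?mulr_ge0 // ltW.
  by rewrite mulrDl mul1r addrC lerD2l.
apply: le_trans (_ : 2 * B / d * d <= _).
  rewrite divfK ?gt_eqF // mulr_natl mulr2n.
  by apply: le_trans (modCB _ _) _; apply: lerD; apply: F_bounded; rewrite // ltW.
apply: ler_pM; rewrite ?divr_ge0 ?mulr_ge0 ?(ltW d0) //.
by rewrite lerDr addr_ge0 ?modC_ge0.
Qed.

Let c (y : R) : CC R := circ r (2 * pi * y).

Let modC_c y : modC (c y) = r. Proof. exact: modC_circ. Qed.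

Let trap_small e : 0 < e -> exists K, forall k, (K <= k)%N ->
  modC (trap k (G \o c) c 0 1) <= e.
Proof.
move=> e0; have [M M0 hM] := G_bounded.
(* The circle c has Lipschitz constant at most 2 (2 pi) r, by [cis_lipschitz]. This also exceeds |c
   y - z| <= 2 r, so a single L serves both directions of the homotopy. *)
pose L := 4 * pi * r.
have L0 : 0 <= L by rewrite !mulr_ge0 ?pi_ge0 // ltW.
have Lr : 2 * r <= L.
  by rewrite /L ler_wpM2r ?ltW //; have := @pi_ge2 R; lra.
pose t0 : R := Order.min 1 (e / (2 * (M * L + 1))).
have ML : 0 < M * L + 1 by rewrite ltr_wpDl // mulr_ge0.
have t00 : 0 < t0 by rewrite lt_min ltr01 divr_gt0 // mulr_gt0.
have t01 : t0 <= 1 by rewrite ge_min lexx.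
have t0e : M * (L * t0) <= e / 2.
  have : t0 * (2 * (M * L + 1)) <= e.
    by rewrite -ler_pdivlMr ?mulr_gt0 // ge_min lexx orbT.
  by move: t00; lra.
pose al (x : R) := t0 + (1 - t0) * x.
have al01 x : 0 <= x <= 1 -> 0 < al x <= 1.
  move=> /andP[x0 x1]; have : 0 <= (1 - t0) * x by rewrite mulr_ge0 // subr_ge0.
  have : (1 - t0) * x <= (1 - t0) * 1 by rewrite ler_wpM2l // subr_ge0.
  by rewrite /al; lra.
(* At x = 0 the loop C x is so small that its trapezoid sum is at most e / 2. *)
pose C x y := z + realC (al x) * (c y - z).
have cL s t : s <= t -> modC (c t - c s) <= L * (t - s).
  move=> st; rewrite /c /circ -mulrBr modCM modC_real gtr0_norm //.
  have -> : L * (t - s) = r * (2 * (2 * pi * t - 2 * pi * s)) by rewrite /L; ring.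
  rewrite ler_wpM2l ?(ltW r0) // cis_lipschitz //.
  by rewrite ler_wpM2l // mulr_ge0 ?pi_ge0.
have Cr x y : 0 <= x <= 1 -> modC (C x y) <= r.
  move=> x01; have /andP[a0 a1] := al01 x x01.
  apply: modC_convex; [by rewrite a1 ltW|exact: ltW|by rewrite modC_c].
have Cz x y : 0 <= x <= 1 -> C x y != z.
  move=> x01; have /andP[a0 a1] := al01 x x01.
  rewrite -subr_eq0 /C addrC addKr mulf_neq0 //.
    by rewrite realC_eq0 gt_eqF.
  rewrite subr_eq0; apply/negP => /eqP h; have := modC_c y; rewrite h => zE.
  by move: zr; rewrite zE ltxx.
have [||||K hK] := @goursat_square R G C L _ _ _ (e / 2).
- move=> y s t _ s0 st t1.
  have -> : C t y - C s y = realC ((1 - t0) * (t - s)) * (c y - z).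
    by rewrite /C /al !(realCD, realCM, realCN); ring.
  have h1 : 0 <= (1 - t0) * (t - s) by rewrite mulr_ge0 // subr_ge0.
  rewrite modCM modC_real ger0_norm // mulrC.
  apply: ler_pM; rewrite ?modC_ge0 //.
    apply: le_trans (modCB _ _) _; rewrite modC_c; move: zr Lr; lra.
  by rewrite ler_piMl ?subr_ge0 //; move: t00; lra.
- move=> x s t x01 s0 st t1.
  have -> : C x t - C x s = realC (al x) * (c t - c s) by rewrite /C; ring.
  have /andP[a0 a1] := al01 x x01.
  rewrite modCM modC_real gtr0_norm //.
  by apply: le_trans (cL s t st); rewrite ler_piMl ?modC_ge0.
- by move=> x y x01 y01; apply: cdiff_quot; [exact: Cz|apply: F_cdiff; exact: Cr].
- by rewrite divr_gt0.
exists K => k /hK; rewrite /bdry !add0r.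
have C1 : C 1 = c.
  have al1 : al 1 = 1 by rewrite /al; ring.
  by apply/funext => y; rewrite /C al1 realC1 mul1r addrC subrK.
(* The sides y = 0 and y = 1 have the same image and cancel, so only the loops at x = 0 and x = 1
   remain. *)
have c01 : c 1 = c 0 by rewrite /c mulr1 mulr0 /circ cis2pi cis0.
have -> : (fun x y : R => G (C x y)) ^~ 1 = (fun x y : R => G (C x y)) ^~ 0.
  by apply/funext => x; rewrite /C c01.
have -> : C ^~ 1 = C ^~ 0 by apply/funext => x; rewrite /C c01.
rewrite C1 => h.
set T := trap k (fun y => G (c y)) c 0 1 in h *.
set T0 := trap k _ (C 0) 0 1 in h; set X := trap k _ _ 0 1 in h.
have -> : T = (X + T - X - T0) + T0 by ring.
apply: le_trans (modCD _ _) _; rewrite (splitr e); apply: lerD => //.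
apply: le_trans t0e; have -> : L * t0 = L * t0 * (1 - 0) by ring.
apply: trap_le => //.
  by move=> t _; apply: hM; apply: Cr; rewrite lexx ler01.
move=> s t _ st _.
have -> : C 0 t - C 0 s = realC t0 * (c t - c s).
  by rewrite /C /al mulr0 addr0; ring.
rewrite modCM modC_real gtr0_norm // mulrAC mulrC ler_wpM2r ?cL //.
exact: ltW.
Qed.

(* Summation by parts turns the trapezoid sum into an average over roots. *)
Let abel k : trap k (G \o c) c 0 1 =
  (cis (root_angle k 1) - (cis (root_angle k 1))^-1) / 2
  * \sum_(0 <= l < 2 ^ k) G (circ r (root_angle k l)) * circ r (root_angle k l).
Proof.
set om := cis _; pose Z l := circ r (root_angle k l).
have om0 : om != 0 by exact: cis_neq0.
have ZS l : Z l.+1 = om * Z l by rewrite /Z /circ root_angleS mulrCA.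
have ZN : Z (2 ^ k)%N = Z 0%N.
  rewrite /Z /circ /root_angle natrX divff ?expf_neq0 // mulr1 cis2pi.
  by rewrite mul0r mulr0 cis0.
rewrite trap_sumE mulr_sumr.
have cE l : c (0 + (1 - 0) * (l%:R / 2 ^+ k)) = Z l.
  by rewrite add0r subr0 mul1r.
under eq_big_nat do rewrite /comp !cE.
have tele (H : nat -> CC R) : H (2 ^ k)%N = H 0%N ->
    \sum_(0 <= l < 2 ^ k) H l.+1 = \sum_(0 <= l < 2 ^ k) H l.
  move=> H0; apply/eqP; rewrite -subr_eq0 -sumrB telescope_sumr //.
  by rewrite H0 subrr.
transitivity (\sum_(0 <= l < 2 ^ k) (om - 1) / 2 * (G (Z l) * Z l) +
    \sum_(0 <= l < 2 ^ k) (1 - om^-1) / 2 * (G (Z l.+1) * Z l.+1)).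
  rewrite -big_split; apply: eq_bigr => l _ /=.
  by rewrite ZS; field.
rewrite (tele (fun l => (1 - om^-1) / 2 * (G (Z l) * Z l))) ?ZN // -big_split.
by apply: eq_bigr => l _ /=; rewrite -/(Z l); field.
Qed.

(** Says that G(w) w has mean zero on the circle. The mean of the kernel stays as a factor, because
    its value 1 is itself obtained from this lemma in [cmean_kernel]. *)
Lemma cauchy_formula_weighted :
  cmean circle_mean (fun t => F (circ r t) * (1 / (1 - z / circ r t))) =
  F z * cmean circle_mean (fun t => 1 / (1 - z / circ r t)).
Proof.
have bF : cbounded (fun t => F (circ r t)).
  by exists B => t; apply: F_bounded; rewrite modC_circ.
have bK := cbounded_kernel r0 zr.
apply/eqP; rewrite -subr_eq0 -cmeanZ // -cmeanB //; [|exact: cboundedM|exact: cboundedZ].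
have -> : (fun t => F (circ r t) * (1 / (1 - z / circ r t)) -
    F z * (1 / (1 - z / circ r t))) = fun t => G (circ r t) * circ r t.
  apply/funext => t; have c0 := circ_neq0 t r0.
  rewrite /G; field; rewrite c0 subr_eq0 andbT; apply/negP => /eqP h.
  by have := modC_circ t r0; rewrite h => zE; move: zr; rewrite zE ltxx.
have [M M0 hM] := G_bounded.
apply/eqP/cmean_circle0.
  by apply: cboundedM; [exists M|exists r] => t; rewrite ?hM ?modC_circ.
move=> e e0; have [K hK] := trap_small (mulr_gt0 e0 ltr01).
(* The shift by 2 matches [root_gap]: as |om^2 - 1| >= 8 / 2^(k+2), a small trapezoid sum means that
   the sum over the roots is small compared with their number. *)
exists (K.+2) => -[|[|k]] // /ltnW/ltnW/hK; rewrite mulr1 abel.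
set om := cis _; set S := \sum_(_ <= _ < _) _ => h.
have om0 : om != 0 by exact: cis_neq0.
have h2 : 2 * modC (om - om^-1) * 2 ^+ k.+2 >= 16.
  have := root_gap k; rewrite -/om => h8.
  have -> : om - om^-1 = (om ^+ 2 - 1) / om by field.
  by rewrite modCM modCV modC_cis invr1 mulr1; lra.
have {}h : modC (om - om^-1) * modC S <= 2 * e.
  by move: h; rewrite !modCM modCV modC_nat; lra.
have S0 := modC_ge0 S.
have p0 : (0 : R) < 2 ^+ k.+2 by rewrite exprn_gt0.
have : 16 * modC S <= 2 * modC (om - om^-1) * 2 ^+ k.+2 * modC S.
  by rewrite ler_wpM2r.
have : modC (om - om^-1) * modC S * 2 ^+ k.+2 <= 2 * e * 2 ^+ k.+2.
  by rewrite ler_wpM2r // ltW.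
have : 0 <= e * 2 ^+ k.+2 by rewrite mulr_ge0 // ltW.
lra.
Qed.

End Formula.

Lemma cmean_kernel z r : modC z < r ->
  cmean circle_mean (fun t => 1 / (1 - z / circ r t)) = 1.
Proof.
move=> zr; have r0 : 0 < r by exact: le_lt_trans (modC_ge0 _) zr.
have rr0 : realC r != 0 by rewrite realC_eq0 gt_eqF.
have [->|z0] := eqVneq z 0.
  under eq_fun do rewrite mul0r subr0 divr1.
  exact: cmean_circle_cst.
(* On the circle the kernel is the conjugate of 1 / (1 - a w), which is
   holomorphic on the closed disc, so Cauchy's formula at 0 applies to it. *)
pose a := z^* / realC r ^+ 2.
have a0 : a != 0 by rewrite mulf_neq0 ?invr_eq0 ?expf_neq0 // conjC_eq0.
have ma : modC a = modC z / r ^+ 2.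
  by rewrite modCM modCV modCX modCJ modC_real gtr0_norm.
have q1 : modC z / r < 1 by rewrite ltr_pdivrMr ?mul1r.
have aw w : modC w <= r -> modC (a * w) <= modC z / r.
  move=> wr; rewrite modCM ma; apply: le_trans (_ : modC z / r ^+ 2 * r <= _).
    by rewrite ler_wpM2l // divr_ge0 ?modC_ge0 // sqr_ge0.
  by rewrite le_eqVlt; apply/orP; left; apply/eqP; field; rewrite gt_eqF.
have aw1 w : modC w <= r -> 1 - a * w != 0.
  move=> /aw h; rewrite subr_eq0; apply/negP => /eqP E.
  by move: h; rewrite -E modC1 leNgt q1.
pose H (w : CC R) := (0 - a^-1) / (w - a^-1).
have HE w : modC w <= r -> H w = 1 / (1 - a * w).
  move=> /aw1 h; have h' : w * a - 1 != 0.
    by rewrite -oppr_eq0 opprB mulrC.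
  by rewrite /H; field; rewrite ?h ?h' ?a0.
have := @cauchy_formula_weighted H r 0 (1 / (1 - modC z / r)).
rewrite modC0 r0 => /(_ isT) /= E.
have K0 : (fun t => 1 / (1 - 0 / circ r t)) = fun=> 1.
  by apply/funext => t; rewrite mul0r subr0 divr1.
have HK : (fun t => H (circ r t) * (1 / (1 - 0 / circ r t))) =
    fun t => H (circ r t).
  by apply/funext => t; rewrite mul0r subr0 divr1 mulr1.
have H0 : H 0 = 1 by rewrite HE ?modC0 ?(ltW r0) // mulr0 subr0 divr1.
rewrite K0 HK H0 cmean_circle_cst mulr1 in E.
have {}E : cmean circle_mean (fun t => H (circ r t)) = 1.
  apply: E.
  - move=> w wr; apply: cdiff_quot; last exact: cdiff_cst.
    apply/negP => /eqP h; have := aw1 w wr; rewrite h divff // subrr eqxx //.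
  - move=> w wr; rewrite HE // !div1r modCV lef_pV2 ?posrE ?subr_gt0 //.
      have := aw w wr; have := modCD (1 - a * w) (a * w); rewrite subrK modC1; lra.
    by rewrite modC_gt0 aw1.
rewrite -[LHS]conjCK -cmeanJ; last exact: cbounded_kernel.
rewrite -[RHS]conjC1; congr (_^*); rewrite -[RHS]E.
congr (cmean _ _); apply/funext => t; rewrite HE ?modC_circ //.
rewrite !div1r fmorphV rmorphB rmorph1 fmorph_div; congr (_^-1); congr (1 - _).
have c0 := circ_neq0 t r0.
have cc : circ r t * (circ r t)^* = realC r ^+ 2.
  by rewrite mulCJ modC_circ // realCX.
rewrite /a -cc; field; by rewrite c0 conjC_eq0 c0.
Qed.

Theorem cauchy_formula F r z B : modC z < r ->
  (forall w, modC w <= r -> cdiff_at F w) ->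
  (forall w, modC w <= r -> modC (F w) <= B) ->
  F z = cmean circle_mean (fun t => F (circ r t) * (1 / (1 - z / circ r t))).
Proof.
by move=> zr dF bF; rewrite (cauchy_formula_weighted zr dF bF) cmean_kernel ?mulr1.
Qed.

End CauchyFormula.

(** * Power series *)

Section Exhaustion.
Variables (R : realType) (I : choiceType) (E : nat -> seq I).
Hypothesis E_uniq : forall M, uniq (E M).
Hypothesis E_exhausts : forall s : seq I,
  exists M0, forall M, (M0 <= M)%N -> {subset s <= E M}.

(** The supremum over finite sets behind [esum] is attained along the lists [E M], since every
    finite set is contained in all late lists. *)
Lemma esum_exhaustion (v : I -> R) (C : R) : (forall i, 0 <= v i) ->
  (forall M, \sum_(i <- E M) v i <= C) ->
  exists2 S, esum setT (fun i => (v i)%:E) = S%:E &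
  forall e : R, 0 < e -> exists M0, forall M, (M0 <= M)%N ->
    `|\sum_(i <- E M) v i - S| <= e.
Proof.
move=> v0 hC; set T := esum _ _.
have fsE (A : set I) : finite_set A ->
    (\sum_(i \in A) (v i)%:E = (\sum_(i <- fset_set A) v i)%:E)%E.
  by move=> fA; rewrite fsbig_finite //= sumEFin.
have boxT M : ((\sum_(i <- E M) v i)%:E <= T)%E.
  apply: esum_ge; exists [set` E M]; first by split => //; exact: finite_seq.
  by rewrite -sumEFin (fsbig_seq _ _ (E_uniq M)).
have sub (A : set I) : finite_set A -> exists M0, forall M, (M0 <= M)%N ->
    \sum_(i <- fset_set A) v i <= \sum_(i <- E M) v i.
  move=> fA; have [M0 hM0] := E_exhausts (fset_set A); exists M0 => M /hM0 sAM.
  rewrite -lee_fin -!sumEFin (fsbig_seq _ _ (E_uniq M)).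
  rewrite (fsbig_seq _ _ (fset_uniq _)).
  apply: lee_fsum_nneg_subset; try exact: finite_seq.
  - by move=> i; rewrite !mem_setE; exact: sAM.
  - by move=> i _; rewrite lee_fin.
have TC : (T <= C%:E)%E.
  apply: ge_ereal_sup => _ [A [fA _] <-]; rewrite fsE // lee_fin.
  by have [M0 hM0] := sub A fA; exact: le_trans (hM0 M0 (leqnn _)) (hC _).
have T0 : (0 <= T)%E by apply: esum_ge0 => i _; rewrite lee_fin.
have Tfin : T \is a fin_num by rewrite ge0_fin_numE // (le_lt_trans TC) ?ltry.
exists (fine T); first by rewrite fineK.
move=> e e0; have [_ [A [fA _] <-]] := ub_ereal_sup_adherent e0 Tfin.
rewrite -[ereal_sup _]/T -{1}(fineK Tfin) fsE // -EFinB lte_fin => hA.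
have [M0 hM0] := sub A fA; exists M0 => M /hM0 hM.
have := boxT M; rewrite -{1}(fineK Tfin) lee_fin => h.
by rewrite ler_norml; apply/andP; split; lra.
Qed.

Lemma has_sum_exhaustion (u : I -> R) (s C : R) :
  (forall M, \sum_(i <- E M) `|u i| <= C) ->
  (forall e : R, 0 < e -> exists M0, forall M, (M0 <= M)%N ->
    `|\sum_(i <- E M) u i - s| <= e) ->
  has_sum u s.
Proof.
move=> hC hs; pose p i := Num.max (u i) 0; pose q i := Num.max (- u i) 0.
have p0 i : 0 <= p i by rewrite le_max lexx orbT.
have q0 i : 0 <= q i by rewrite le_max lexx orbT.
have pu i : p i <= `|u i| by rewrite ge_max ler_norm normr_ge0.
have qu i : q i <= `|u i| by rewrite ge_max -normrN ler_norm normr_ge0.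
have pq i : u i = p i - q i.
  by rewrite /p /q; case: (leP (u i) 0) => h; case: (leP (- u i) 0) => h'; lra.
have hp M : \sum_(i <- E M) p i <= C.
  by apply: le_trans (hC M); apply: ler_sum => i _.
have hq M : \sum_(i <- E M) q i <= C.
  by apply: le_trans (hC M); apply: ler_sum => i _.
have [P PE hP] := esum_exhaustion p0 hp.
have [Q QE hQ] := esum_exhaustion q0 hq.
have [N NE _] := esum_exhaustion (fun i => normr_ge0 (u i)) hC.
split.
  by rewrite /summable; under eq_esum do rewrite /= ; rewrite NE ltry.
have -> : (fun i => (u i)%:E)^\+%E = (fun i => (p i)%:E)
  by apply/funext => i; rewrite funeposE /p EFin_max.
have -> : (fun i => (u i)%:E)^\-%E = (fun i => (q i)%:E)
  by apply/funext => i; rewrite funenegE /q EFin_max EFinN.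
rewrite PE QE -EFinB; congr EFin.
apply/eqP; rewrite -subr_eq0 -normr_le0; apply/ler_addgt0Pr => e e0.
have e3 : 0 < e / 3 by rewrite divr_gt0.
have [[M1 h1] [M2 h2] [M3 h3]] := And3 (hs _ e3) (hP _ e3) (hQ _ e3).
pose M := maxn M1 (maxn M2 M3).
have m1 := h1 M (leq_maxl _ _).
have m2 := h2 M (leq_trans (leq_maxl _ _) (leq_maxr _ _)).
have m3 := h3 M (leq_trans (leq_maxr _ _) (leq_maxr _ _)).
have SE : \sum_(i <- E M) u i = \sum_(i <- E M) p i - \sum_(i <- E M) q i.
  by rewrite -sumrB; apply: eq_bigr => i _.
rewrite add0r.
have -> : s - (P - Q) = - (\sum_(i <- E M) u i - s) +
  ((\sum_(i <- E M) p i - P) - (\sum_(i <- E M) q i - Q)) by rewrite SE; ring.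
apply: le_trans (ler_normD _ _) _; rewrite normrN.
have -> : e = e / 3 + (e / 3 + e / 3) by field.
apply: lerD => //; apply: le_trans (ler_normB _ _) _; exact: lerD.
Qed.

End Exhaustion.

Section PowerSeries.
Variables (R : realType) (K : finType).

(** Cubes of multi-indices, chosen because sums over them factor into one-variable sums, see
    [sum_box]. *)
Definition box M : seq {ffun K -> nat} :=
  [seq [ffun j => val (f j)] | f : {ffun K -> 'I_M}].

Lemma box_uniq M : uniq (box M).
Proof.
rewrite map_inj_uniq ?enum_uniq // => f g /ffunP fg; apply/ffunP => j.
by apply: val_inj; have := fg j; rewrite !ffunE.
Qed.

Lemma mem_box M (m : {ffun K -> nat}) : (forall j, m j < M)%N -> m \in box M.
Proof.
move=> mM; apply/mapP; exists [ffun j => Ordinal (mM j)]; first exact: mem_enum.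
by apply/ffunP => j; rewrite !ffunE.
Qed.

Lemma box_exhausts (s : seq {ffun K -> nat}) :
  exists M0, forall M, (M0 <= M)%N -> {subset s <= box M}.
Proof.
exists (\max_(m <- s) \max_j m j).+1 => M hM m ms; apply: mem_box => j.
apply: leq_trans hM; rewrite ltnS.
apply: (leq_trans (n := \max_j m j)); last first.
  exact: (leq_bigmax_seq (F := fun m : {ffun K -> nat} => \max_j m j)).
exact: (leq_bigmax (F := fun j => m j)).
Qed.

Lemma sum_box (S : comNzRingType) M (g : K -> nat -> S) :
  \sum_(m <- box M) \prod_j g j (m j) = \prod_j \sum_(k < M) g j k.
Proof.
rewrite big_map big_enum bigA_distr_bigA; apply: eq_bigr => f _.
by apply: eq_bigr => j _; rewrite ffunE.
Qed.

(** Factors are replaced one at a time; 1 <= C allows the full power of C to bound every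
    intermediate product. *)
Lemma modC_prod_sub (s : seq K) (u v : K -> CC R) (C e : R) :
  1 <= C -> 0 <= e -> (forall j, modC (u j) <= C) -> (forall j, modC (v j) <= C) ->
  (forall j, modC (u j - v j) <= e) ->
  modC (\prod_(j <- s) u j - \prod_(j <- s) v j) <= (size s)%:R * C ^+ size s * e.
Proof.
move=> C1 e0 hu hv huv; have C0 : 0 <= C by lra.
elim: s => [|j s IH]; first by rewrite !big_nil subrr modC0 !mul0r.
rewrite !big_cons.
set U := \prod_(i <- s) u i in IH *; set V := \prod_(i <- s) v i in IH *.
have VC : modC V <= C ^+ size s.
  rewrite /V modC_prod; elim: (s) => [|i t IHt]; first by rewrite big_nil.
  by rewrite big_cons exprS ler_pM ?modC_ge0 ?prodr_ge0 // => k _; exact: modC_ge0.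
have -> : u j * U - v j * V = u j * (U - V) + (u j - v j) * V by ring.
apply: le_trans (modCD _ _) _; rewrite !modCM /= -natr1 exprS.
have -> : ((size s)%:R + 1) * (C * C ^+ size s) * e =
  C * ((size s)%:R * C ^+ size s * e) + e * (C * C ^+ size s) by ring.
apply: lerD; first by apply: ler_pM; rewrite ?modC_ge0.
apply: ler_pM; rewrite ?modC_ge0 //; apply: le_trans VC _.
by rewrite ler_peMl // exprn_ge0.
Qed.

Lemma geometric_half (y : CC R) M : modC y <= 2^-1 ->
  [/\ modC (\sum_(k < M) y ^+ k) <= 2, modC (1 / (1 - y)) <= 2
    & modC (\sum_(k < M) y ^+ k - 1 / (1 - y)) <= 2 * 2^-1 ^+ M].
Proof.
move=> y2.
have h1 : modC (1 / (1 - y)) <= 2.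
  have := @modC_kernel R y 1 1 ltr01 (modC1 R); rewrite !divr1 => /(_ _) h.
  apply: le_trans (h _) _; first by move: y2; lra.
  rewrite ler_pdivrMr; move: y2; lra.
have y1 : 1 - y != 0.
  rewrite subr_eq0; apply/negP => /eqP E; move: y2; rewrite -E modC1; lra.
split => //.
  apply: le_trans (modC_sum _ _ _) _.
  apply: le_trans (_ : \sum_(k < M) (2^-1 : R) ^+ k <= _).
    by apply: ler_sum => k _; rewrite modCX lerXn2r ?nnegrE ?modC_ge0.
  have : (2^-1 - 1) * \sum_(k < M) (2^-1 : R) ^+ k = 2^-1 ^+ M - 1 by rewrite -subrX1.
  have : 0 <= (2^-1 : R) ^+ M by rewrite exprn_ge0.
  lra.
have -> : \sum_(k < M) y ^+ k - 1 / (1 - y) = - (y ^+ M) * (1 / (1 - y)).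
  apply: (mulfI y1); rewrite mulrBr.
  have -> : (1 - y) * \sum_(k < M) y ^+ k = 1 - y ^+ M.
    by have := subrX1 y M; rewrite -(opprB y) mulNr => <-; ring.
  by field.
rewrite modCM modCN modCX mulrC; apply: ler_pM; rewrite ?modC_ge0 ?exprn_ge0 ?modC_ge0 //.
by rewrite lerXn2r ?nnegrE ?modC_ge0.
Qed.

(** The Cauchy kernels are expanded under the mean. Keeping x within rho / 2 makes all geometric
    ratios at most 1/2, uniformly in the index of the mean. *)
Lemma kernel_has_sum (I : Type) (L : mean R I) (G : I -> CC R)
    (w : K -> I -> CC R) (rho B : R) (x : K -> R) :
  0 < rho -> 0 <= B -> (forall i, modC (G i) <= B) ->
  (forall j i, modC (w j i) <= rho^-1) -> (forall j, `|x j| <= rho / 2) ->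
  has_sum (fun m : {ffun K -> nat} =>
      re (cmean L (fun i => G i * \prod_j w j i ^+ m j)) * \prod_j x j ^+ m j)
    (re (cmean L (fun i => G i * \prod_j (1 / (1 - realC (x j) * w j i))))).
Proof.
move=> rho0 B0 hG hw hx.
have bG : cbounded G by exists B.
have bw j : cbounded (w j) by exists rho^-1.
have ri0 : 0 <= rho^-1 by rewrite invr_ge0 ltW.
have hy i j : modC (realC (x j) * w j i) <= 2^-1.
  rewrite modCM modC_real; apply: le_trans (_ : rho / 2 * rho^-1 <= _).
    by apply: ler_pM; rewrite ?modC_ge0.
  by rewrite mulrAC divff ?mul1r // gt_eqF.
have bm (m : {ffun K -> nat}) : cbounded (fun i => G i * \prod_j w j i ^+ m j).
  by apply: cboundedM => //; apply: cbounded_prod => j; exact: cboundedX.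
have bP (g : K -> I -> CC R) : (forall j i, modC (g j i) <= 2) ->
    cbounded (fun i => G i * \prod_j g j i).
  by move=> hg; apply: cboundedM => //; apply: cbounded_prod => j; exists 2.
pose a m := cmean L (fun i => G i * \prod_j w j i ^+ m j).
have xE (m : {ffun K -> nat}) : re (a m) * \prod_j x j ^+ m j =
    re (a m * \prod_j realC (x j) ^+ m j).
  have -> : \prod_j realC (x j) ^+ m j = realC (\prod_j x j ^+ m j).
    by rewrite realC_prod; apply: eq_bigr => j _; rewrite realCX.
  by rewrite reM /= mulr0 subr0.
(* A box sum is exactly the mean with each kernel replaced by its truncated geometric series, so
   convergence reduces to a uniform estimate under the mean. *)
have boxE M : \sum_(m <- box M) re (a m) * \prod_j x j ^+ m j =
    re (cmean L (fun i => G i * \prod_j \sum_(k < M) (realC (x j) * w j i) ^+ k)).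
  under eq_bigr do rewrite xE; rewrite -re_sum; congr re.
  transitivity (cmean L (fun i => \sum_(m <- box M)
      (\prod_j realC (x j) ^+ m j) * (G i * \prod_j w j i ^+ m j))).
    rewrite cmean_sum; last by move=> m; exact: cboundedZ.
    by apply: eq_bigr => m _; rewrite cmeanZ // mulrC.
  congr (cmean L _); apply/funext => i.
  rewrite -(sum_box M (fun j k => (realC (x j) * w j i) ^+ k)) mulr_sumr.
  apply: eq_bigr => m _; rewrite mulrCA -big_split; congr (_ * _).
  by apply: eq_bigr => j _; rewrite exprMn.
(* The leading 2 comes from [modC_cmean], and each variable contributes a geometric series with sum
   at most 2. *)
apply: (has_sum_exhaustion box_uniq box_exhausts (C := 2 * B * 2 ^+ #|K|)) => [M|e e0].
  apply: le_trans (_ : \sum_(m <- box M) 2 * B * \prod_j (2^-1 : R) ^+ m j <= _).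
    apply: ler_sum => m _; rewrite normrM normr_prod.
    have ma : modC (a m) <= 2 * (B * \prod_j rho^-1 ^+ m j).
      apply: modC_cmean => [i|]; last first.
        by rewrite mulr_ge0 // prodr_ge0 // => j _; rewrite exprn_ge0.
      rewrite modCM ler_pM ?modC_ge0 // modC_prod.
      by apply: ler_prod => j _; rewrite modC_ge0 modCX lerXn2r ?nnegrE ?modC_ge0.
    apply: le_trans (_ : 2 * (B * \prod_j rho^-1 ^+ m j) *
        \prod_j (rho / 2) ^+ m j <= _).
      apply: ler_pM => //; first by rewrite prodr_ge0.
        exact: le_trans (le_re_modC _) ma.
      apply: ler_prod => j _; rewrite normr_ge0 normrX lerXn2r ?nnegrE //.
      by rewrite divr_ge0 // ltW.
    rewrite -!mulrA -big_split /= ler_wpM2l // ler_wpM2l //.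
    apply: ler_prod => j _; rewrite -exprMn mulrA mulVf ?gt_eqF // mul1r lexx andbT.
    by rewrite exprn_ge0.
  rewrite -mulr_sumr (sum_box M (fun j k => (2^-1 : R) ^+ k)) ler_wpM2l ?mulr_ge0 //.
  rewrite prodr_const lerXn2r ?nnegrE ?sumr_ge0 //.
  have := (@geometric_half (realC 2^-1) M).
  rewrite modC_real ger0_norm // => /(_ (lexx _)) [+ _ _].
  have -> : \sum_(k < M) realC 2^-1 ^+ k = realC (\sum_(k < M) (2^-1 : R) ^+ k).
    by apply: CC_ext; rewrite ?re_sum ?im_sum /=; [apply: eq_bigr|apply: big1]
      => k _; rewrite -realCX.
  by rewrite modC_real ger0_norm // sumr_ge0.
(* This is [modC_prod_sub] for factors bounded by 2 and a truncation error of 2 * 2^-M in each,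
   followed by [modC_cmean]. *)
pose C := 2 * (B * (#|K|%:R * 2 ^+ #|K| * 2)).
have C0 : 0 <= C by rewrite /C !mulr_ge0 // exprn_ge0.
have [M0 hM0] := @half_power_lt R (e / (C + 1)) ltac:(by rewrite divr_gt0 // ltr_wpDl).
exists M0 => M hM; rewrite boxE -reB -cmeanB; last first.
- by apply: bP => j i; case: (geometric_half M (hy i j)).
- by apply: bP => j i; case: (geometric_half M (hy i j)).
apply: le_trans (le_re_modC _) _.
apply: le_trans (_ : C * 2^-1 ^+ M <= _); last first.
  have : (2^-1 : R) ^+ M <= 2^-1 ^+ M0 by rewrite ler_wiXn2l //; lra.
  move: hM0; rewrite ltr_pdivlMr ?ltr_wpDl // => h1 h2.
  have h3 : C * 2^-1 ^+ M <= C * 2^-1 ^+ M0 by rewrite ler_wpM2l.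
  have : 0 < (2^-1 : R) ^+ M0 by rewrite exprn_gt0.
  by move: h1 h3; lra.
have -> : C * 2^-1 ^+ M = 2 * (B * (#|K|%:R * 2 ^+ #|K| * (2 * 2^-1 ^+ M))).
  by rewrite /C; ring.
apply: modC_cmean => [i|]; last by rewrite !mulr_ge0 // exprn_ge0.
rewrite -mulrBr modCM ler_pM ?modC_ge0 //.
have -> : #|K| = size (index_enum K) by rewrite cardE enumT.
apply: modC_prod_sub => //; first by lra.
- by move=> j; case: (geometric_half M (hy i j)).
- by move=> j; case: (geometric_half M (hy i j)).
- by move=> j; case: (geometric_half M (hy i j)).
Qed.

End PowerSeries.

(** * Functions on polydiscs *)

Section ComplexDerivative.
Variable R : realType.
Implicit Types (F G : CC R -> CC R) (w : CC R).

Lemma cdiff_bounded F w : cdiff_at F w -> exists D,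
  exists2 d, 0 < d & forall z, modC (z - w) < d ->
    modC (F z - F w) <= (modC D + 1) * modC (z - w).
Proof.
move=> [D hD]; have [d d0 hd] := hD 1 ltr01; exists D, d => // z /hd.
rewrite mul1r => h; have -> : F z - F w = (F z - F w - D * (z - w)) + D * (z - w) by ring.
apply: le_trans (modCD _ _) _; rewrite modCM mulrDl mul1r addrC.
by rewrite lerD2l.
Qed.

Lemma cdiffM F G w : cdiff_at F w -> cdiff_at G w ->
  cdiff_at (fun z => F z * G z) w.
Proof.
move=> hF hG; have [D hD] := hF; have [D' hD'] := hG.
have [A [d1 d10 h1]] := cdiff_bounded hF.
exists (D * G w + F w * D') => e e0.
set a := modC A; have a0 : 0 <= a := modC_ge0 A.
set b := modC (G w); have b0 : 0 <= b := modC_ge0 (G w).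
set f := modC (F w); have f0 : 0 <= f := modC_ge0 (F w).
set c := modC D'; have c0 : 0 <= c := modC_ge0 D'.
pose e1 := e / (4 * (b + 1)); pose e2 := e / (4 * (f + 1)).
have e10 : 0 < e1 by rewrite divr_gt0 // mulr_gt0 // ltr_wpDl.
have e20 : 0 < e2 by rewrite divr_gt0 // mulr_gt0 // ltr_wpDl.
have b4 : e1 * b <= e / 4.
  have -> : e / 4 = e1 * (b + 1) by rewrite /e1; field; rewrite gt_eqF // ltr_wpDl.
  by rewrite ler_wpM2l ?lerDl // ltW.
have f4 : f * e2 <= e / 4.
  have -> : e / 4 = (f + 1) * e2 by rewrite /e2; field; rewrite gt_eqF // ltr_wpDl.
  by rewrite ler_wpM2r ?lerDl // ltW.
have [d2 d20 h2] := hD _ e10; have [d3 d30 h3] := hD' _ e20.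
have [d4 d40 h4] := hD' 1 ltr01.
pose d5 := e / (4 * (a + 1) * (c + 1)).
have d50 : 0 < d5 by rewrite divr_gt0 // !mulr_gt0 // ltr_wpDl.
exists (Order.min (Order.min d1 d2) (Order.min (Order.min d3 d4) d5)).
  by rewrite !lt_min d10 d20 d30 d40.
move=> z; rewrite !lt_min => /andP[/andP[z1 z2] /andP[/andP[z3 z4] z5]].
move: (h1 z z1) (h2 z z2) (h3 z z3) (h4 z z4) z5.
set x := modC (z - w) => k1 k2 k3 k4 k5.
have x0 : 0 <= x := modC_ge0 _.
have -> : F z * G z - F w * G w - (D * G w + F w * D') * (z - w) =
  (F z - F w - D * (z - w)) * G w + F w * (G z - G w - D' * (z - w))
  + (F z - F w) * (G z - G w) by ring.
have k6 : modC (G z - G w) <= (c + 1) * x.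
  have -> : G z - G w = (G z - G w - D' * (z - w)) + D' * (z - w) by ring.
  apply: le_trans (modCD _ _) _; rewrite modCM mulrDl addrC; exact: lerD.
have -> : e * x = e / 4 * x + e / 4 * x + e / 2 * x by field.
apply: le_trans (modCD _ _) _; apply: lerD; first (apply: le_trans (modCD _ _) _; apply: lerD).
- rewrite modCM; apply: le_trans (_ : e1 * x * b <= _); first by rewrite ler_wpM2r.
  by rewrite mulrAC ler_wpM2r.
- rewrite modCM; apply: le_trans (_ : f * (e2 * x) <= _); first by rewrite ler_wpM2l.
  by rewrite mulrA ler_wpM2r.
- rewrite modCM; apply: le_trans (_ : ((a + 1) * x) * ((c + 1) * x) <= _).
    by apply: ler_pM; rewrite ?modC_ge0.
  have -> : (a + 1) * x * ((c + 1) * x) = ((a + 1) * (c + 1) * x) * x by ring.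
  rewrite ler_wpM2r //; apply: le_trans (_ : (a + 1) * (c + 1) * d5 <= _).
    by rewrite ler_wpM2l ?ltW // mulr_gt0 // ltr_wpDl.
  rewrite /d5 [leLHS](_ : _ = e / 4); first by lra.
  by field; rewrite !gt_eqF ?ltr_wpDl.
Qed.

Lemma cdiffJ F w : cdiff_at F w^* -> cdiff_at (fun z => (F z^*)^*) w.
Proof.
move=> [D hD]; exists D^* => e e0; have [d d0 hd] := hD e e0.
exists d => // z zw; have := hd z^*; rewrite -rmorphB modCJ => /(_ zw).
suff -> : (F z^*)^* - (F w^*)^* - D^* * (z - w) =
  (F z^* - F w^* - D * (z - w)^*)^* by rewrite modCJ.
by apply: CC_ext; rewrite !reimE; ring.
Qed.

Lemma cdiff_shift F w : cdiff_at (fun t => F (w + t)) 0 -> cdiff_at F w.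
Proof.
move=> [D hD]; exists D => e e0; have [d d0 hd] := hD e e0; exists d => // z.
have := hd (z - w); rewrite subr0 addr0.
by have -> : w + (z - w) = z by ring.
Qed.

End ComplexDerivative.

Section Polydisc.
Variables (R : realType) (K : finType).
Implicit Types (X : K -> CC R) (r : R).

Definition upd (T : Type) (X : K -> T) j a : K -> T := fun i => if i == j then a else X i.

Lemma upd_upd (T : Type) (X : K -> T) j a b : upd (upd X j a) j b = upd X j b.
Proof. by apply/funext => i; rewrite /upd; case: eqP. Qed.

Lemma upd_id (T : Type) (X : K -> T) j : upd X j (X j) = X.
Proof. by apply/funext => i; rewrite /upd; case: eqP => // ->. Qed.

Lemma updE (T : Type) (X : K -> T) j a : upd X j a j = a.
Proof. by rewrite /upd eqxx. Qed.

(** Angles of variables outside [s] are frozen at 0, so that all lists share the index type [K -> R]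
    and the induction can add one variable at a time. *)
Fixpoint torus_mean (s : seq K) : mean R (K -> R) :=
  if s is j :: s' then
    map_mean (bind_mean (@circle_mean R) (fun=> torus_mean s'))
      (fun a => upd a.2 j a.1)
  else dirac_mean R (fun=> 0).

Variables (F : (K -> CC R) -> CC R) (r B : R).
Hypothesis F_cdiff : forall X j, (forall i, modC (X i) <= r) ->
  cdiff_at (fun w => F (upd X j w)) (X j).
Hypothesis F_bounded : forall X, (forall i, modC (X i) <= r) -> modC (F X) <= B.

Let onto_torus (s : seq K) X (th : K -> R) : K -> CC R :=
  fun i => if i \in s then circ r (th i) else X i.

(** The one-variable formula is applied coordinate by coordinate. Coordinates already moved lie on
    the circle of radius r, hence the weak bound on all of X; the strict bound concerns the
    coordinates of [s], still to be treated. *)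
Lemma torus_cauchy (s : seq K) X : 0 < r -> uniq s ->
  (forall i, modC (X i) <= r) -> (forall i, i \in s -> modC (X i) < r) ->
  F X = cmean (torus_mean s) (fun th => F (onto_torus s X th) *
          \prod_(i <- s) (1 / (1 - X i / circ r (th i)))).
Proof.
move=> r0; elim: s X => [|j s IH] X.
  by move=> *; rewrite /cmean /= big_nil mulr1; apply: CC_ext; rewrite reimE.
move=> /= /andP[js us] Xr Xs.
have Xj : modC (X j) < r by apply: Xs; rewrite inE eqxx.
have updr w : modC w <= r -> forall i, modC (upd X j w i) <= r.
  by move=> wr i; rewrite /upd; case: eqP.
have -> : F X = F (upd X j (X j)) by rewrite upd_id.
rewrite (@cauchy_formula R (fun w => F (upd X j w)) r (X j) B) //; last first.
- by move=> w /updr; exact: F_bounded.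
- move=> w wr; have := @F_cdiff (upd X j w) j (updr _ wr).
  by rewrite updE; under eq_fun do rewrite upd_upd.
rewrite cmean_map cmean_bind; congr (cmean _ _); apply/funext => t.
have mt : modC (circ r t) = r by rewrite modC_circ.
have bt i : modC (upd X j (circ r t) i) <= r by apply: updr; rewrite mt.
have Xs' i : i \in s -> modC (upd X j (circ r t) i) < r.
  move=> si; rewrite /upd; case: eqP => [ij|_]; first by rewrite -ij si in js.
  by apply: Xs; rewrite inE si orbT.
rewrite (IH _ us bt Xs') mulrC -cmeanZ; last first.
  apply: cboundedM.
    exists B => th; apply: F_bounded => i; rewrite /onto_torus.
    by case: ifP => _; rewrite ?modC_circ.
  elim: (s) Xs' => [|i s' IHs] Xs'.
    by under eq_fun do rewrite big_nil; exact: cbounded_cst.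
  under eq_fun do rewrite big_cons; apply: cboundedM; last first.
    by apply: IHs => k ks; apply: Xs'; rewrite inE ks orbT.
  have [b hb] := cbounded_kernel r0 (Xs' i (mem_head _ _)).
  by exists b => th; exact: hb.
congr (cmean _ _); apply/funext => th; rewrite /= big_cons updE.
have -> : onto_torus s (upd X j (circ r t)) th = onto_torus (j :: s) X (upd th j t).
  apply/funext => i; rewrite /onto_torus inE /upd.
  by case: eqP => [->|//]; rewrite (negPf js).
rewrite mulrCA; congr (_ * (_ * _)); apply: eq_big_seq => i si.
by rewrite /upd; case: eqP => [ij|//]; rewrite -ij si in js.
Qed.

Lemma polydisc_cauchy X : (forall i, modC (X i) < r) -> 0 < r ->
  F X = cmean (torus_mean (enum K)) (fun th => F (fun i => circ r (th i)) *
          \prod_i (1 / (1 - X i * (circ r (th i))^-1))).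
Proof.
move=> Xr r0; rewrite (torus_cauchy r0 (enum_uniq K)) => [||i _]; last exact: Xr.
  congr (cmean _ _); apply/funext => th; rewrite big_enum; congr (F _ * _).
  by apply/funext => i; rewrite /onto_torus mem_enum.
by move=> i; exact: ltW.
Qed.

End Polydisc.

(** * Power series of a mean of holomorphic functions *)

Section MeanOfHolomorphic.
Variables (R : realType) (K : finType) (I : Type) (L : mean R I).
Variables (F : I -> (K -> CC R) -> CC R) (r B : R).
Hypothesis r0 : 0 < r.
Hypothesis F_cdiff : forall m X j, (forall i, modC (X i) <= r) ->
  cdiff_at (fun w => F m (upd X j w)) (X j).
Hypothesis F_bounded : forall m X, (forall i, modC (X i) <= r) -> modC (F m X) <= B.

(** Nesting the torus mean inside L gives a single mean, so the coefficients of the whole family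
    come from one application of [kernel_has_sum]; the bound B must not depend on the member of the
    family. *)
Lemma mean_has_sum : exists a : {ffun K -> nat} -> R,
  forall x : K -> R, (forall j, `|x j| <= r / 2) ->
    has_sum (fun m : {ffun K -> nat} => a m * \prod_j x j ^+ m j)
      (re (cmean L (fun m => F m (fun i => realC (x i))))).
Proof.
pose LT := bind_mean L (fun=> @torus_mean R K (enum K)).
pose G (a : I * (K -> R)) := F a.1 (fun i => circ r (a.2 i)).
pose w j (a : I * (K -> R)) := (circ r (a.2 j))^-1.
exists (fun m => re (cmean LT (fun i => G i * \prod_j w j i ^+ m j))) => x hx.
have -> : cmean L (fun m => F m (fun i => realC (x i))) =
    cmean LT (fun i => G i * \prod_j (1 / (1 - realC (x j) * w j i))).
  rewrite cmean_bind; congr (cmean L _); apply/funext => m.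
  apply: (polydisc_cauchy (B := B)) => // [X j|X|i]; [exact: F_cdiff|exact: F_bounded|].
  rewrite modC_real; apply: le_lt_trans (hx i) _.
  by move: r0; lra.
have hG i : modC (G i) <= `|B|.
  by apply: le_trans (F_bounded _ _) (ler_norm _) => j; rewrite modC_circ.
apply: kernel_has_sum hG _ hx => // j i.
by rewrite modCV modC_circ.
Qed.

End MeanOfHolomorphic.

(** * The Levi form of a mean of squares *)

Section Polydiscs.
Variables (R : realType) (n : nat).
Implicit Types (p q v : 'rV[CC R]_n) (f : 'rV[CC R]_n -> CC R) (r : R).

Definition in_polydisc p r q := forall k, modC (q 0 k - p 0 k) <= r.

(** Complex differentiability at each point along each complex line through it: the form in which
    the one-variable Cauchy formula can be applied after any affine substitution. *)
Definition line_holomorphic f p r := forall q, in_polydisc p r q ->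
  forall v, cdiff_at (fun t => f (q + t *: v)) 0.

Let modC_i : modC (mkC 0 1 : CC R) = 1.
Proof. by rewrite /modC /= expr0n expr1n add0r sqrtr1. Qed.

Lemma in_polydisc_trans p q u r s : in_polydisc p r q -> in_polydisc q s u ->
  in_polydisc p (r + s) u.
Proof.
move=> hq hu k; have -> : u 0 k - p 0 k = (q 0 k - p 0 k) + (u 0 k - q 0 k) by ring.
by apply: le_trans (modCD _ _) _; exact: lerD.
Qed.

Lemma in_polydisc_le p q r s : r <= s -> in_polydisc p r q -> in_polydisc p s q.
Proof. by move=> rs h k; exact: le_trans (h k) rs. Qed.

Lemma in_polydisc_delta q (t : CC R) k r : modC t <= r ->
  in_polydisc q r (q + t *: delta_mx 0 k).
Proof.
move=> tr i; rewrite !mxE addrAC subrr add0r modCM; case: (i == k).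
  by rewrite modC1 mulr1.
by rewrite modC0 mulr0; exact: le_trans (modC_ge0 _) tr.
Qed.

Lemma line_holomorphic_cdiff f p r q v w : line_holomorphic f p r ->
  in_polydisc p r (q + w *: v) -> cdiff_at (fun t => f (q + t *: v)) w.
Proof.
move=> hf hq; apply: cdiff_shift; have := hf _ hq v.
by under [in X in _ -> X]eq_fun do rewrite scalerDl addrA.
Qed.

(** From 1 / (1 - q) = 1 + q + q^2 / (1 - q) with q = t / z and |1 / (1 - q)| <= 2, the other factor
    2 being that of [modC_cmean]. The explicit constant is what allows differentiation under an
    arbitrary mean. *)
Lemma cauchy_taylor2 (F : CC R -> CC R) r (B : R) (t : CC R) : 0 < r ->
  (forall w, modC w <= r -> cdiff_at F w) ->
  (forall w, modC w <= r -> modC (F w) <= B) -> modC t <= r / 2 ->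
  modC (F t - F 0 - t * cmean (@circle_mean R) (fun th => F (circ r th) / circ r th))
    <= 4 * B / r ^+ 2 * modC t ^+ 2.
Proof.
move=> r0 dF bF tr; have tr' : modC t < r by move: tr r0; lra.
have z0 : modC (0 : CC R) < r by rewrite modC0.
have bFc : cbounded (fun th => F (circ r th)).
  by exists B => th; apply: bF; rewrite modC_circ.
have B0 : 0 <= B by apply: le_trans (modC_ge0 _) (bF 0 (ltW z0)).
have bV : cbounded (fun th => F (circ r th) / circ r th).
  apply: cboundedM bFc _; exists r^-1 => th; by rewrite modCV modC_circ.
have bK z : modC z < r -> cbounded (fun th => F (circ r th) * (1 / (1 - z / circ r th))).
  by move=> zr; apply: cboundedM bFc (cbounded_kernel r0 zr).
rewrite (cauchy_formula tr' dF bF) (cauchy_formula z0 dF bF) -cmeanZ //.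
rewrite -cmeanB; [|exact: bK..].
rewrite -cmeanB; [|exact: cboundedB (bK _ tr') (bK _ z0)|exact: cboundedZ].
have -> : 4 * B / r ^+ 2 * modC t ^+ 2 = 2 * (2 * B * modC t ^+ 2 / r ^+ 2) by ring.
apply: modC_cmean => [th|]; last first.
  by rewrite !mulr_ge0 ?exprn_ge0 ?modC_ge0 // invr_ge0 exprn_ge0 // ltW.
set z := circ r th; have mz : modC z = r by rewrite modC_circ.
have zn0 : z != 0 by exact: circ_neq0.
clearbody z.
have zt : z - t != 0.
  rewrite subr_eq0; apply/negP => /eqP E; by move: tr'; rewrite -E mz ltxx.
have -> : F z * (1 / (1 - t / z)) - F z * (1 / (1 - 0 / z)) - t * (F z / z) =
  F z * t ^+ 2 / z ^+ 2 * (1 / (1 - t / z)).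
  by rewrite mul0r subr0 divr1 mulr1; field; rewrite zt zn0.
have hk : modC (1 / (1 - t / z)) <= 2.
  apply: le_trans (modC_kernel r0 mz tr') _.
  have h : modC t / r <= 2^-1 by rewrite ler_pdivrMr //; move: tr; lra.
  rewrite ler_pdivrMr; move: h; lra.
have hF : modC (F z) <= B by apply: bF; rewrite mz.
rewrite mulrC; move: (1 / _) hk => k hk.
rewrite !(modCX, modCM, modCV) mz -!mulrA.
apply: ler_pM; rewrite ?modC_ge0 ?mulr_ge0 ?invr_ge0 ?exprn_ge0 ?modC_ge0 ?(ltW r0) //.
by rewrite ler_wpM2r // !mulr_ge0 ?invr_ge0 ?exprn_ge0 ?modC_ge0 ?(ltW r0).
Qed.

Section Family.
Variables (I : Type) (L : mean R I) (f : I -> 'rV[CC R]_n -> CC R).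
Hypothesis f1 : forall m u, modC (f m u) <= 1.

Definition mean_sq (u : 'rV[CC R]_n) : R := L (fun m => modC (f m u) ^+ 2).

Lemma mean_sqE u : realC (mean_sq u) = cmean L (fun m => f m u * (f m u)^*).
Proof.
apply: CC_ext; rewrite !reimE; first by congr (mean_fun L _);
  apply/funext => m; rewrite /= mulCJ.
rewrite -[LHS](mul0r (L (fun=> 0))) -meanZ; last exact: bounded_cst.
by congr (mean_fun L _); apply/funext => m; rewrite /= mulCJ mul0r.
Qed.

Let row_of (X : 'I_n + 'I_n -> CC R) : 'rV[CC R]_n :=
  \row_k (X (inl k) + mkC 0 1 * X (inr k)).

Lemma real_analytic_mean_sq p r : 0 < r -> (forall m, line_holomorphic (f m) p r) ->
  real_analytic_at mean_sq p.
Proof.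
move=> r0 hf; have r20 : 0 < r / 2 by rewrite divr_gt0.
pose Fm (g : 'rV[CC R]_n -> CC R) (X : 'I_n + 'I_n -> CC R) := g (p + row_of X).
(* The holomorphic extension of |f_m|^2 from real to complex coordinates. *)
pose Phi m X := Fm (f m) X * (Fm (f m) (fun i => (X i)^*))^*.
have inp X : (forall i, modC (X i) <= r / 2) -> in_polydisc p r (p + row_of X).
  move=> hX k; rewrite !mxE addrAC subrr add0r; apply: le_trans (modCD _ _) _.
  by rewrite modCM modC_i mul1r (splitr r); apply: lerD.
have dF m X j : (forall i, modC (X i) <= r / 2) ->
    cdiff_at (fun w => Fm (f m) (upd X j w)) (X j).
  move=> hX; apply: cdiff_shift.
  pose e : 'rV[CC R]_n := match j with inl k => delta_mx 0 k
                          | inr k => mkC 0 1 *: delta_mx 0 k end.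
  have E t : p + row_of (upd X j (X j + t)) = (p + row_of X) + t *: e.
    rewrite -addrA; congr (p + _); apply/rowP => k; rewrite !mxE /upd /e.
    case: (j) => i; rewrite !mxE eqxx /= ?(inj_eq (@inl_inj _ _)) ?(inj_eq (@inr_inj _ _)).
      by case: eqVneq => [->|_] /=; rewrite ?mulr1 ?mulr0 ?addr0 //; ring.
    case: eqVneq => [->|_] /=; rewrite ?mulr1 ?mulr0 ?addr0 //; ring.
  have := hf m _ (inp _ hX) e.
  by rewrite /Fm; under [in X in _ -> X]eq_fun do rewrite E.
have dPhi m X j : (forall i, modC (X i) <= r / 2) ->
    cdiff_at (fun w => Phi m (upd X j w)) (X j).
  move=> hX; apply: cdiffM; first exact: dF.
  have hX' i : modC ((X i)^*) <= r / 2 by rewrite modCJ.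
  (* The second factor of [Phi] has the form conj (F (conj w)), which is again holomorphic in w. *)
  have := cdiffJ (F := fun w => Fm (f m) (upd (fun i => (X i)^*) j w)) (dF m _ j hX').
  congr cdiff_at; apply/funext => w; congr ((Fm _ _)^*); apply/funext => i.
  by rewrite /upd; case: eqP.
have bPhi m X : (forall i, modC (X i) <= r / 2) -> modC (Phi m X) <= 1.
  by move=> _; rewrite modCM modCJ mulr_ile1 ?modC_ge0 ?f1.
have [a ha] := mean_has_sum L r20 dPhi bPhi.
(* One factor 1/2 pays for X and Y both entering the coordinate X + iY, the other for the kernel
   expansion in [mean_has_sum]. *)
exists a, (r / 4); split; first by rewrite divr_gt0.
move=> h hr; have hr' i : `|rcoord h i| <= r / 2 / 2.
  by apply: le_trans (ltW (hr i)) _; move: r0; lra.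
have := ha (rcoord h) hr'; congr has_sum.
have rowE : row_of (fun i => realC (rcoord h i)) = h.
  apply/rowP => k; rewrite !mxE /=; apply: CC_ext; rewrite !reimE /=; ring.
have -> : cmean L (fun m => Phi m (fun i => realC (rcoord h i))) = realC (mean_sq (p + h)).
  rewrite mean_sqE; congr (cmean L _); apply/funext => m.
  rewrite /Phi /Fm rowE; congr (_ * (f m (p + _))^*).
  rewrite -[RHS]rowE; congr row_of; apply/funext => i.
  by apply: CC_ext; rewrite !reimE ?oppr0.
by [].
Qed.

End Family.

Lemma derive1_taylor2 (h : R -> R) (D C d : R) : 0 < d ->
  (forall t, `|t| <= d -> `|h t - h 0 - t * D| <= C * t ^+ 2) ->
  derive1 h 0 = D.
Proof.
move=> d0 hh; apply/cvg_lim => //; apply/cvgrPdist_le => e e0.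
have C0 : 0 <= C.
  have := hh d; rewrite gtr0_norm // lexx => /(_ isT) H.
  have : 0 <= C * d ^+ 2 by apply: le_trans H.
  by rewrite pmulr_lge0 // exprn_gt0.
have m0 : 0 < Order.min d (e / (C + 1)) by rewrite lt_min d0 divr_gt0 // ltr_wpDl.
near=> t.
have t0 : t != 0 by near: t; exact: nbhs_dnbhs_neq.
have : `|t| <= Order.min d (e / (C + 1)) by near: t; apply: dnbhs0_le.
rewrite le_min => /andP[td te].
rewrite addr0 /GRing.scale /=.
have -> : D - t^-1 * (h t - h 0) = - (t^-1 * (h t - h 0 - t * D)) by field.
rewrite normrN normrM normfV mulrC ler_pdivrMr ?normr_gt0 //.
apply: le_trans (hh t td) _; rewrite -[t ^+ 2]real_normK ?num_real // expr2 mulrA.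
rewrite ler_wpM2r //; apply: le_trans (_ : (C + 1) * (e / (C + 1)) <= _).
  by apply: ler_pM => //; rewrite lerDl.
by rewrite mulrC divfK // gt_eqF // ltr_wpDl.
Unshelve. all: by end_near. Qed.

Lemma rderive_taylor2 (u : 'rV[CC R]_n -> CC R) v z (D : CC R) (C d : R) : 0 < d ->
  (forall t : R, `|t| <= d ->
    modC (u (z + realC t *: v) - u z - realC t * D) <= C * t ^+ 2) ->
  rderive u v z = D.
Proof.
move=> d0 hu; apply: CC_ext; rewrite /rderive !reimE;
  apply: (derive1_taylor2 (C := C) d0) => t td; have := hu t td;
  rewrite -/(realC 0) realC0 scale0r addr0 -/(realC t); apply: le_trans.
- by have := le_re_modC (u (z + realC t *: v) - u z - realC t * D);
    rewrite !reimE mul0r subr0.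
- by have := le_im_modC (u (z + realC t *: v) - u z - realC t * D);
    rewrite !reimE mul0r addr0.
Qed.

(** Real t shows that the derivative along the coordinate is P + Q, and imaginary t that the
    derivative along i times it is i (P - Q); the two Wirtinger combinations then isolate P and
    Q. *)
Lemma wirtinger_taylor2 (u : 'rV[CC R]_n -> CC R) j z (P Q : CC R) (C d : R) : 0 < d ->
  (forall t, modC t <= d ->
    modC (u (z + t *: delta_mx 0 j) - u z - t * P - t^* * Q) <= C * modC t ^+ 2) ->
  wirtinger j u z = P /\ wirtinger_bar j u z = Q.
Proof.
move=> d0 hu.
have D1 : rderive u (delta_mx 0 j) z = P + Q.
  apply: (rderive_taylor2 (C := C) d0) => t td.
  have := hu (realC t); rewrite modC_real => /(_ td).
  have -> : (realC t)^* = realC t by apply: CC_ext; rewrite !reimE ?oppr0.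
  by rewrite real_normK ?num_real // mulrDr opprD addrA.
have D2 : rderive u (mkC 0 1 *: delta_mx 0 j) z = mkC 0 1 * P - mkC 0 1 * Q.
  apply: (rderive_taylor2 (C := C) d0) => t td.
  have := hu (realC t * mkC 0 1); rewrite modCM modC_real modC_i mulr1 => /(_ td).
  have -> : (realC t * mkC 0 1)^* = - (realC t * mkC 0 1).
    by apply: CC_ext; rewrite !reimE; ring.
  rewrite real_normK ?num_real // scalerA; congr (modC _ <= _); ring.
have ii : mkC 0 1 * mkC 0 1 = -1 :> CC R by apply: CC_ext; rewrite !reimE; ring.
have i2 (y : CC R) : mkC 0 1 * (mkC 0 1 * y) = - y by rewrite mulrA ii mulN1r.
by rewrite /wirtinger /wirtinger_bar D1 D2 mulrBr !i2; split; field.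
Qed.

(** Product rule for a holomorphic times an antiholomorphic factor. The cross term t a conj (h - h0)
    is quadratic because |h - h0| <= (C + B) |t|. *)
Lemma modC_sub_mulJ (g0 h0 a b g h t : CC R) (B C : R) :
  modC g0 <= B -> modC h0 <= B -> modC h <= B -> modC a <= B -> 
  modC (g - g0 - t * a) <= C * modC t ^+ 2 ->
  modC (h - h0 - t * b) <= C * modC t ^+ 2 -> modC t <= 1 -> modC b <= B -> 0 <= C ->
  modC (g * h^* - g0 * h0^* - t * (a * h0^*) - t^* * (g0 * b^*)) <=
    (2 * B * C + B * (C + B)) * modC t ^+ 2.
Proof.
move=> hg0 hh0 hh ha hg hhb t1 hb C0.
have B0 : 0 <= B := le_trans (modC_ge0 _) hg0.
have -> : g * h^* - g0 * h0^* - t * (a * h0^*) - t^* * (g0 * b^*) =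
  (g - g0 - t * a) * h^* + g0 * (h - h0 - t * b)^* + t * a * (h - h0)^*.
  by apply: CC_ext; rewrite !reimE; ring.
have hd : modC (h - h0) <= (C + B) * modC t.
  have -> : h - h0 = (h - h0 - t * b) + t * b by ring.
  apply: le_trans (modCD _ _) _; rewrite mulrDl; apply: lerD.
    by apply: le_trans hhb _; rewrite ler_wpM2l // expr2 ler_piMl ?modC_ge0.
  by rewrite modCM mulrC ler_wpM2r ?modC_ge0.
have -> : (2 * B * C + B * (C + B)) * modC t ^+ 2 = (C * modC t ^+ 2) * B +
  B * (C * modC t ^+ 2) + (modC t * B) * ((C + B) * modC t) by ring.
apply: le_trans (modCD _ _) _; apply: lerD; first (apply: le_trans (modCD _ _) _; apply: lerD).
- by rewrite modCM modCJ; apply: ler_pM; rewrite ?modC_ge0.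
- by rewrite modCM modCJ; apply: ler_pM; rewrite ?modC_ge0.
- rewrite modCM modCJ; apply: ler_pM; rewrite ?modC_ge0 // modCM.
  by rewrite ler_wpM2l ?modC_ge0.
Qed.

Lemma cmean_mulJ_taylor2 (I : Type) (L : mean R I) (g h : CC R -> I -> CC R)
    (a b : I -> CC R) (B C d : R) (t : CC R) :
  d <= 1 -> 0 <= d -> modC t <= d ->
  (forall w m, modC w <= d -> modC (g w m) <= B) ->
  (forall w m, modC w <= d -> modC (h w m) <= B) ->
  (forall m, modC (a m) <= B) -> (forall m, modC (b m) <= B) ->
  (forall m, modC (g t m - g 0 m - t * a m) <= C * modC t ^+ 2) ->
  (forall m, modC (h t m - h 0 m - t * b m) <= C * modC t ^+ 2) -> 0 <= C -> 0 <= B ->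
  modC (cmean L (fun m => g t m * (h t m)^*) - cmean L (fun m => g 0 m * (h 0 m)^*)
     - t * cmean L (fun m => a m * (h 0 m)^*) - t^* * cmean L (fun m => g 0 m * (b m)^*))
   <= 2 * (2 * B * C + B * (C + B)) * modC t ^+ 2.
Proof.
move=> d1 d0 td hg hh ha hb hgt hht C0 B0.
have z0 : modC (0 : CC R) <= d by rewrite modC0.
have bg w : modC w <= d -> cbounded (g w) by move=> wd; exists B => m; exact: hg.
have bh w : modC w <= d -> cbounded (fun m => (h w m)^*).
  by move=> wd; exists B => m; rewrite modCJ; exact: hh.
have ba : cbounded a by exists B.
have bb : cbounded (fun m => (b m)^*) by exists B => m; rewrite modCJ.
have b1 := cboundedM (bg _ td) (bh _ td); have b2 := cboundedM (bg _ z0) (bh _ z0).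
have b3 := cboundedM ba (bh _ z0); have b4 := cboundedM (bg _ z0) bb.
have b5 := cboundedB b1 b2; have b6 := cboundedZ t b3.
have b7 := cboundedB b5 b6; have b8 := cboundedZ t^* b4.
rewrite -!cmeanZ // -!cmeanB //.
rewrite -mulrA; apply: modC_cmean => [m|]; last first.
  by rewrite mulr_ge0 ?exprn_ge0 ?modC_ge0 // !addr_ge0 ?mulr_ge0 // addr_ge0.
apply: modC_sub_mulJ => //; [exact: hg|exact: hh|exact: hh|exact: le_trans td d1].
Qed.

(** Cauchy's integral for the partial derivative in z_k. As a mean over a circle of fixed radius it
    has bounds uniform over functions bounded by 1; [diff_cauchy_partial] identifies it with the
    differential. *)
Definition cauchy_partial f r z k : CC R :=
  cmean (@circle_mean R) (fun th => f (z + circ r th *: delta_mx 0 k) / circ r th).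

Section LeviForm.
Variables (I : Type) (L : mean R I) (f : I -> 'rV[CC R]_n -> CC R) (p : 'rV[CC R]_n) (r : R).
Hypothesis f1 : forall m u, modC (f m u) <= 1.
Hypothesis r01 : 0 < r <= 1.
Hypothesis fh : forall m, line_holomorphic (f m) p (3 * r).

Let r0 : 0 < r. Proof. by case/andP: r01. Qed.
Let r1 : r <= 1. Proof. by case/andP: r01. Qed.

Let pd m z k := cauchy_partial (f m) r z k.

(** The radius 3 r leaves room for a circle of radius r around any z within 2 r of p; such z include
    points p + t e_j and points on circles around p. *)
Lemma partial_taylor2 m z k t : in_polydisc p (2 * r) z -> modC t <= r / 2 ->
  modC (f m (z + t *: delta_mx 0 k) - f m z - t * pd m z k) <= 4 / r ^+ 2 * modC t ^+ 2.
Proof.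
move=> hz tr.
have := @cauchy_taylor2 (fun t => f m (z + t *: delta_mx 0 k)) r 1 t r0.
rewrite scale0r addr0 mulr1; apply => //.
move=> w wr; apply: line_holomorphic_cdiff (fh m) _.
have -> : 3 * r = 2 * r + r by ring.
by apply: in_polydisc_trans hz _; exact: in_polydisc_delta.
Qed.

Lemma modC_partial m z k : modC (pd m z k) <= 2 / r.
Proof.
apply: modC_cmean => [th|]; last by rewrite invr_ge0 ltW.
rewrite modCM modCV modC_circ // -[leRHS]mul1r.
by rewrite ler_wpM2r // invr_ge0 ltW.
Qed.

(** The expansion in direction j is inserted under the circle mean in direction k, so the mixed
    second derivative appears as an iterated circle mean. *)
Lemma partial_partial_taylor2 m j k t : modC t <= r / 2 ->
  modC (pd m (p + t *: delta_mx 0 j) k - pd m p k - t *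
    cmean (@circle_mean R) (fun th => pd m (p + circ r th *: delta_mx 0 k) j / circ r th))
  <= 8 / r ^+ 3 * modC t ^+ 2.
Proof.
move=> tr; have bV : cbounded (fun th => (circ r th)^-1).
  by exists r^-1 => th; rewrite modCV modC_circ.
have bf z : cbounded (fun th => f m (z + circ r th *: delta_mx 0 k) / circ r th).
  by apply: cboundedM => //; exists 1 => th.
have bp : cbounded (fun th => pd m (p + circ r th *: delta_mx 0 k) j / circ r th).
  by apply: cboundedM => //; exists (2 / r) => th; exact: modC_partial.
rewrite -cmeanZ // -cmeanB // -cmeanB; [|exact: cboundedB|exact: cboundedZ].
have -> : 8 / r ^+ 3 * modC t ^+ 2 = 2 * (4 / r ^+ 2 * modC t ^+ 2 * r^-1).
  by field; rewrite gt_eqF.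
apply: modC_cmean => [th|]; last first.
  by rewrite !mulr_ge0 ?invr_ge0 ?exprn_ge0 ?modC_ge0 // ltW.
set c := circ r th.
have -> : f m (p + t *: delta_mx 0 j + c *: delta_mx 0 k) / c -
    f m (p + c *: delta_mx 0 k) / c - t * (pd m (p + c *: delta_mx 0 k) j / c) =
  (f m ((p + c *: delta_mx 0 k) + t *: delta_mx 0 j) - f m (p + c *: delta_mx 0 k) -
   t * pd m (p + c *: delta_mx 0 k) j) / c.
  by rewrite (addrAC p); ring.
rewrite modCM modCV modC_circ // ler_wpM2r ?invr_ge0 ?(ltW r0) //.
apply: partial_taylor2 => //; apply: (@in_polydisc_le _ _ r).
  by move: r0; lra.
by apply: in_polydisc_delta; rewrite modC_circ.
Qed.

Let u (z : 'rV[CC R]_n) : CC R := realC (mean_sq L f z).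

Let d := r / 2.
Let d0 : 0 < d. Proof. by rewrite divr_gt0. Qed.
(** A common bound for f (by 1), for its partials (by 2 / r), for the second partials and for the
    Taylor constant of [partial_taylor2]. *)
Let B := 4 / r ^+ 2.
Let pB : 2 / r <= B.
Proof.
rewrite /B ler_pdivrMr // mulrAC ler_pdivlMr ?exprn_gt0 // expr2.
have : r * r <= r * 1 by rewrite ler_wpM2l // ltW.
move: r0; nra.
Qed.
Let B1 : 1 <= B.
Proof. by rewrite /B ler_pdivlMr ?exprn_gt0 // expr2; move: r0 r1; nra. Qed.

Lemma wirtinger_bar_mean_sq z k : in_polydisc p (2 * r) z ->
  wirtinger_bar k u z = cmean L (fun m => f m z * (pd m z k)^*).
Proof.
move=> hz; have B1' := B1; have B0 : 0 <= B by lra.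
apply: (wirtinger_taylor2 (P := cmean L (fun m => pd m z k * (f m z)^*))
  (C := 2 * (2 * B * B + B * (B + B))) d0 _).2 => t td.
have := @cmean_mulJ_taylor2 I L (fun t m => f m (z + t *: delta_mx 0 k))
  (fun t m => f m (z + t *: delta_mx 0 k)) (fun m => pd m z k) (fun m => pd m z k)
  B B d t.
rewrite /u !mean_sqE scale0r addr0; apply => //.
- by rewrite /d; move: r1 r0; lra.
- exact: ltW.
- by move=> w m _; exact: le_trans (f1 _ _) B1.
- by move=> w m _; exact: le_trans (f1 _ _) B1.
- by move=> m; exact: le_trans (modC_partial _ _ _) pB.
- by move=> m; exact: le_trans (modC_partial _ _ _) pB.
- by move=> m; exact: partial_taylor2.
- by move=> m; exact: partial_taylor2.
Qed.

(** The inner derivative is the mean of f conj (d_k f), known on a neighbourhood of p. Its second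
    factor is antiholomorphic, so the derivative of that factor enters only the coefficient of conj
    t, which d/dz_j ignores. *)
Lemma wirtinger2_mean_sq j k :
  wirtinger j (wirtinger_bar k u) p = cmean L (fun m => pd m p j * (pd m p k)^*).
Proof.
have B1' := B1; have B0 : 0 <= B by lra.
pose C := 8 / r ^+ 3.
have BC : B <= C.
  rewrite /B /C ler_pdivlMr ?exprn_gt0 // mulrAC ler_pdivrMr ?exprn_gt0 //.
  rewrite [r ^+ 3]exprS mulrA ler_wpM2r ?exprn_ge0 ?(ltW r0) //.
  by move: r1; lra.
have rV : r^-1 >= 1 by rewrite invf_ge1.
have C0 : 0 <= C by exact: le_trans BC.
pose b m := cmean (@circle_mean R)
  (fun th => pd m (p + circ r th *: delta_mx 0 k) j / circ r th).
have hb m : modC (b m) <= B.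
  have -> : B = 2 * (2 / r / r) by rewrite /B; field; rewrite gt_eqF.
  apply: modC_cmean => [th|]; last by rewrite !mulr_ge0 ?invr_ge0 // ltW.
  rewrite modCM modCV modC_circ // ler_wpM2r ?invr_ge0 ?(ltW r0) //.
  exact: modC_partial.
have pz t : modC t <= d -> in_polydisc p (2 * r) (p + t *: delta_mx 0 j).
  move=> td; apply: in_polydisc_le (in_polydisc_delta _ _ td).
  by rewrite /d; move: r0; lra.
apply: (wirtinger_taylor2 (Q := cmean L (fun m => f m p * (b m)^*))
  (C := 2 * (2 * B * C + B * (C + B))) d0 _).1 => t td.
have := @cmean_mulJ_taylor2 I L (fun t m => f m (p + t *: delta_mx 0 j))
  (fun t m => pd m (p + t *: delta_mx 0 j) k) (fun m => pd m p j) b B C d t.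
have p0 : in_polydisc p (2 * r) p.
  by have := pz 0; rewrite modC0 scale0r addr0; apply; exact: ltW.
rewrite scale0r addr0 (wirtinger_bar_mean_sq _ (pz _ td)) (wirtinger_bar_mean_sq _ p0).
apply => //.
- by rewrite /d; move: r1 r0; lra.
- exact: ltW.
- by move=> w m _; exact: le_trans (f1 _ _) B1.
- by move=> w m _; exact: le_trans (modC_partial _ _ _) pB.
- by move=> m; exact: le_trans (modC_partial _ _ _) pB.
- move=> m; apply: le_trans (partial_taylor2 _ _ p0 td) _.
  by rewrite ler_wpM2r ?exprn_ge0 ?modC_ge0.
- by move=> m; exact: partial_partial_taylor2.
Qed.

Lemma levi_form_mean_sq v :
  levi_form (mean_sq L f) p v =
  realC (L (fun m => modC (\sum_j v 0 j * pd m p j) ^+ 2)).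
Proof.
have bp j : cbounded (fun m => pd m p j).
  by exists (2 / r) => m; exact: modC_partial.
have bs : cbounded (fun m => \sum_j v 0 j * pd m p j).
  by apply: cbounded_sum => j; exact: cboundedZ.
transitivity (cmean L (fun m => (\sum_j v 0 j * pd m p j) * (\sum_j v 0 j * pd m p j)^*)).
  rewrite /levi_form.
  transitivity (\sum_(j < n) \sum_(k < n)
    cmean L (fun m => v 0 j * (v 0 k)^* * (pd m p j * (pd m p k)^*))).
    apply: eq_bigr => j _; apply: eq_bigr => k _.
    rewrite -[fun z => mkC _ 0]/u wirtinger2_mean_sq cmeanZ; last first.
      by apply: cboundedM => //; exact: cboundedJ.
    by ring.
  under eq_bigr => j _.
    rewrite -cmean_sum; last first.
      by move=> k; apply: cboundedZ; apply: cboundedM => //; exact: cboundedJ.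
    over.
  rewrite -cmean_sum; last first.
    move=> j; apply: cbounded_sum => k; apply: cboundedZ; apply: cboundedM => //.
    exact: cboundedJ.
  congr (cmean L _); apply/funext => m; rewrite mulr_suml; apply: eq_bigr => j _.
  rewrite rmorph_sum mulr_sumr; apply: eq_bigr => k _.
  by rewrite rmorphM; ring.
(* [mean_sqE] is applied to functions constant in the point, merely to turn the mean of z conj z
   into a real mean. *)
exact/esym/(mean_sqE L (fun m _ => \sum_j v 0 j * pd m p j) p).
Qed.

End LeviForm.
End Polydiscs.

(** * Differentials of bounded holomorphic functions *)

Section Differential.
Variables (R : realType) (n : nat).
Implicit Types (p q u v : 'rV[CC R]_n) (g : 'rV[CC R]_n -> CC R).

Lemma ltr_realC (a b : R) : (realC a < realC b) = (a < b).
Proof. exact: ltcR. Qed.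

Lemma ler_realC (a b : R) : (realC a <= realC b) = (a <= b).
Proof. exact: lecR. Qed.

Lemma gt0_realC (e : CC R) : 0 < e -> exists2 d : R, 0 < d & e = realC d.
Proof.
case: e => a b; rewrite ltcE /= => /andP[/eqP b0 a0].
by exists a; rewrite // /realC /mkC b0.
Qed.

Lemma nbhs_polydisc p (A : set 'rV[CC R]_n) :
  nbhs p A <-> exists2 d : R, 0 < d & forall q, in_polydisc p d q -> A q.
Proof.
split=> [/nbhs_ballP[e /= /gt0_realC[d d0 ->] hA]|[d d0 hA]].
  exists (d / 2); first by rewrite divr_gt0.
  move=> q hq; apply: hA; split; first by rewrite -(realC0 R) ltr_realC.
  move=> i k; rewrite (ord1 i) /ball /= distrC norm_modC ltr_realC.
  by apply: le_lt_trans (hq k) _; move: d0; lra.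
apply/nbhs_ballP; exists (realC d); first by rewrite /= -(realC0 R) ltr_realC.
move=> q [_ hq]; apply: hA => k; have := hq 0 k.
by rewrite /ball /= distrC norm_modC ltr_realC => /ltW.
Qed.

Lemma cderive_unique (F : CC R -> CC R) (w D D' : CC R) :
  cderive_at F w D -> cderive_at F w D' -> D = D'.
Proof.
move=> h h'; apply/eqP; rewrite -subr_eq0 -modC_eq0 -[_ == 0]/(_ == 0 :> R).
rewrite eq_le modC_ge0 andbT; apply/ler_addgt0Pr => e e0; rewrite add0r.
have e2 : 0 < e / 2 by rewrite divr_gt0.
have [d d0 hd] := h _ e2; have [d' d'0 hd'] := h' _ e2.
pose s : R := Order.min d d' / 2.
have s0 : 0 < s by rewrite divr_gt0 // lt_min d0.
have zw : w + realC s - w = realC s by ring.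
have ms : modC (realC s) = s by rewrite modC_real gtr0_norm.
have sd : s < d /\ s < d'.
  have : Order.min d d' <= d by rewrite ge_min lexx.
  have : Order.min d d' <= d' by rewrite ge_min lexx orbT.
  by rewrite /s; move: s0; rewrite /s; lra.
have := hd (w + realC s); rewrite zw ms => /(_ sd.1) h1.
have := hd' (w + realC s); rewrite zw ms => /(_ sd.2) h2.
rewrite -(ler_pM2r s0) -{1}ms -modCM.
have -> : (D - D') * realC s = (F (w + realC s) - F w - D' * realC s) -
  (F (w + realC s) - F w - D * realC s) by ring.
apply: le_trans (modCB _ _) _; have -> : e * s = e / 2 * s + e / 2 * s by field.
exact: lerD.
Qed.

Lemma cderive_near (F G : CC R -> CC R) (D : CC R) (d : R) : 0 < d ->
  (forall t, modC t < d -> F t = G t) -> cderive_at F 0 D -> cderive_at G 0 D.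
Proof.
move=> d0 FG hF e e0; have [d' d'0 hd] := hF e e0.
exists (Order.min d d'); first by rewrite lt_min d0.
move=> z; rewrite lt_min => /andP[zd zd']; have := hd z zd'.
have -> : F z = G z by apply: FG; rewrite subr0 in zd.
by have -> : F 0 = G 0 by apply: FG; rewrite modC0.
Qed.

Lemma differentiable_cderive g u v : differentiable g u ->
  cderive_at (fun t => g (u + t *: v)) 0 ('d g u v).
Proof.
move=> dg e e0; have := @diff_derivable _ _ _ g u v dg.
rewrite /derivable => cv.
have {cv}: (fun h : CC R => h^-1 *: ((g \o shift u) (h *: v) - g u)) @ 0^' --> 'd g u v.
  by rewrite -deriveE.
move=> /cvgrPdist_le /(_ (realC e)); rewrite -(realC0 R) ltr_realC => /(_ e0).
rewrite realC0 => /nbhs_ballP [_ /= /gt0_realC[d d0 ->] hd].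
exists d => // t; rewrite subr0 => td; rewrite scale0r addr0.
have [->|t0] := eqVneq t 0.
  by rewrite scale0r addr0 subrr mulr0 subr0 modC0 mulr0.
have := hd t; rewrite /ball /= sub0r normrN norm_modC ltr_realC => /(_ td t0).
rewrite norm_modC ler_realC /GRing.scale /= => h.
have -> : g (u + t *: v) - g u - 'd g u v * t =
   - (t * ('d g u v - t^-1 * (g (t *: v + u) - g u))).
  by rewrite [t *: v + u]addrC; field.
by rewrite modCN modCM mulrC ler_wpM2r ?modC_ge0.
Qed.

Lemma differentiable_cdiff g u v : differentiable g u ->
  cdiff_at (fun t => g (u + t *: v)) 0.
Proof. by move=> dg; exists ('d g u v); exact: differentiable_cderive. Qed.

Lemma taylor2_cderive (F : CC R -> CC R) (D : CC R) (C d : R) : 0 < d ->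
  (forall t, modC t <= d -> modC (F t - F 0 - t * D) <= C * modC t ^+ 2) ->
  cderive_at F 0 D.
Proof.
move=> d0 hF e e0; have C0 : 0 <= `|C| by [].
exists (Order.min d (e / (`|C| + 1))); first by rewrite lt_min d0 divr_gt0 // ltr_wpDl.
move=> t; rewrite subr0 lt_min => /andP[/ltW/hF h te].
rewrite [D * t]mulrC; apply: le_trans h _; rewrite expr2 mulrA ler_wpM2r ?modC_ge0 //.
apply: le_trans (_ : (`|C| + 1) * (e / (`|C| + 1)) <= _); last first.
  by rewrite mulrC divfK // gt_eqF // ltr_wpDl.
apply: le_trans (_ : (`|C| + 1) * modC t <= _).
  by rewrite ler_wpM2r ?modC_ge0 // (le_trans (ler_norm _)) // lerDl.
by rewrite ler_wpM2l ?ltW // ltr_wpDl.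
Qed.

(** A Schwarz-type estimate: since h has size r / N, the function g (q + t h) lives on the disc of
    radius N and is bounded by 1 there. At t = 1 the expansion gives 2 / N + 4 / N^2 <= 6 / N. *)
Lemma line_holomorphic_variation g p q (h : 'rV[CC R]_n) (r : R) N : 0 < r -> (2 <= N)%N ->
  (forall u, modC (g u) <= 1) -> line_holomorphic g p (3 * r) ->
  in_polydisc p r q -> (forall j, modC (h 0 j) <= r / N%:R) ->
  modC (g (q + h) - g q) <= 6 / N%:R.
Proof.
move=> r0 N2 g1 gh hq hh.
have N0 : 0 < N%:R :> R by rewrite ltr0n; exact: leq_trans N2.
have N2R : 2 <= N%:R :> R by rewrite ler_nat.
pose F (t : CC R) := g (q + t *: h).
have -> : g (q + h) - g q = F 1 - F 0 by rewrite /F scale1r scale0r addr0.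
have inF w : modC w <= N%:R -> in_polydisc p (3 * r) (q + w *: h).
  move=> wN; apply: (@in_polydisc_le _ _ _ _ (r + r)); first by move: r0; lra.
  apply: in_polydisc_trans hq _ => j; rewrite !mxE addrAC subrr add0r modCM.
  apply: le_trans (_ : N%:R * (r / N%:R) <= _).
    by apply: ler_pM; rewrite ?modC_ge0.
  by rewrite mulrC divfK ?gt_eqF.
have dF w : modC w <= N%:R -> cdiff_at F w.
  by move=> wN; apply: line_holomorphic_cdiff gh _; exact: inF.
have bF w : modC w <= N%:R -> modC (F w) <= 1 by move=> _; exact: g1.
have N12 : modC (1 : CC R) <= N%:R / 2 by rewrite modC1; move: N2R; lra.
have := cauchy_taylor2 N0 dF bF N12.
rewrite modC1 mul1r expr1n !mulr1; set D := cmean _ _ => h1.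
have hD : modC D <= 2 / N%:R.
  apply: modC_cmean => [th|]; last by rewrite invr_ge0 (ltW N0).
  rewrite modCM modCV (modC_circ _ N0); apply: ler_piMl; last exact: g1.
  by rewrite invr_ge0 (ltW N0).
rewrite -(subrK D (F 1 - F 0)); apply: le_trans (modCD _ _) _.
have -> : 6 / N%:R = 4 / N%:R + 2 / N%:R :> R by field; rewrite gt_eqF.
apply: lerD => //; apply: le_trans h1 _.
rewrite expr2 invfM mulrA ler_piMr ?divr_ge0 ?(ltW N0) //.
by rewrite invf_le1 //; move: N2R; lra.
Qed.

(** * Differentials as Cauchy averages, and nondegeneracy near a point *)

Section Local.
Variables (p : 'rV[CC R]_n) (r : R) (I : Type) (g : I -> 'rV[CC R]_n -> CC R).
Hypothesis r01 : 0 < r <= 1.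
Hypothesis g1 : forall i u, modC (g i u) <= 1.
Hypothesis gh : forall i, line_holomorphic (g i) p (3 * r).
Hypothesis gd : forall i q, in_polydisc p (2 * r) q -> differentiable (g i) q.

Let r0 : 0 < r. Proof. by case/andP: r01. Qed.

(** Both sides are linear in v, and on a basis vector both are the derivative of g along the same
    line. *)
Lemma diff_cauchy_partial i z v : in_polydisc p (2 * r) z ->
  'd (g i) z v = \sum_k v 0 k * cauchy_partial (g i) r z k.
Proof.
move=> hz; rewrite [in LHS](row_sum_delta v) linear_sum; apply: eq_bigr => k _.
rewrite linearZ; congr (_ * _).
apply: (@cderive_unique (fun t => g i (z + t *: delta_mx 0 k)) 0).
  by apply: differentiable_cderive; exact: gd.
have r20 : 0 < r / 2 by rewrite divr_gt0.
apply: (taylor2_cderive (C := 4 / r ^+ 2) r20) => t tr.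
rewrite scale0r addr0.
exact: (partial_taylor2 g1 r01 gh i k hz tr).
Qed.

(** Moving the centre translates the circle, so the variation of the partial is an average of
    variations of g. *)
Lemma cauchy_partial_continuous N i z k : (2 <= N)%N ->
  in_polydisc p (r / N%:R) z ->
  modC (cauchy_partial (g i) r z k - cauchy_partial (g i) r p k) <= 12 / r / N%:R.
Proof.
move=> N2 hz; have N0 : 0 < N%:R :> R by rewrite ltr0n; exact: leq_trans N2.
have N2R : 2 <= N%:R :> R by rewrite ler_nat.
have bf q : cbounded (fun th => g i (q + circ r th *: delta_mx 0 k) / circ r th).
  by exists r^-1 => th; rewrite modCM modCV modC_circ // ler_piMl ?invr_ge0 ?(ltW r0).
rewrite -cmeanB //.
have -> : 12 / r / N%:R = 2 * (6 / N%:R / r) by field; rewrite !gt_eqF.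
apply: modC_cmean => [th|]; last by rewrite !divr_ge0 // ltW.
rewrite -mulrBl modCM modCV modC_circ // ler_wpM2r ?invr_ge0 ?(ltW r0) //.
have -> : z + circ r th *: delta_mx 0 k = (p + circ r th *: delta_mx 0 k) + (z - p).
  by rewrite addrAC [p + (z - p)]addrC subrK.
apply: line_holomorphic_variation (gh i) _ _ => //.
- by apply: in_polydisc_delta; rewrite modC_circ.
- by move=> j; rewrite !mxE; exact: hz.
Qed.

End Local.

Section Nondegenerate.
Variables (p : 'rV[CC R]_n) (r : R) (m : nat) (g : 'I_m -> 'rV[CC R]_n -> CC R).
Hypothesis r01 : 0 < r <= 1.
Hypothesis g1 : forall i u, modC (g i u) <= 1.
Hypothesis gh : forall i, line_holomorphic (g i) p (3 * r).
Hypothesis gd : forall i q, in_polydisc p (2 * r) q -> differentiable (g i) q.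
Hypothesis g_nondeg : forall v : 'rV[CC R]_n, v != 0 -> exists i, 'd (g i) p v != 0.

Let r0 : 0 < r. Proof. by case/andP: r01. Qed.

(** The matrix [A p] of partials has independent rows, hence a right inverse W. If v is killed at z
    then v = v (A p - A z) W, and near p this map contracts the l1 norm, which forces v = 0. *)
Lemma nondegenerate_near : exists2 d : R, 0 < d & forall z, in_polydisc p d z ->
  forall v : 'rV[CC R]_n, v != 0 -> exists i, 'd (g i) z v != 0.
Proof.
pose A z : 'M[CC R]_(n, m) := \matrix_(k, i) cauchy_partial (g i) r z k.
have AE z v i : in_polydisc p (2 * r) z -> (v *m A z) 0 i = 'd (g i) z v.
  move=> hz; rewrite (diff_cauchy_partial r01 g1 gh gd) // mxE.
  by apply: eq_bigr => k _; rewrite mxE.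
have pp : in_polydisc p (2 * r) p.
  by move=> k; rewrite subrr modC0 mulr_ge0 // ltW.
have Afree : row_free (A p).
  rewrite -kermx_eq0; apply/rowV0P => v /sub_kermxP vA.
  apply/eqP; apply: contraT => vn0; have [i gi] := g_nondeg vn0.
  by move: gi; rewrite -AE // vA mxE eqxx.
pose W := pinvmx (A p).
have AW : A p *m W = 1%:M by exact: mulmxVp.
pose w : R := \sum_i \sum_k modC (W i k).
have w0 : 0 <= w by do 2 (apply: sumr_ge0 => ? _); exact: modC_ge0.
(* T / N is the contraction factor: 12 / (r N) bounds the entries of A p - A z, w those of W, and n
   coordinates are summed. *)
pose T := n%:R * w * 12 / r.
have T0 : 0 <= T by rewrite !mulr_ge0 ?invr_ge0 // ltW.
pose N := (Num.bound T).+2.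
have N2 : (2 <= N)%N by [].
have N0 : 0 < N%:R :> R by rewrite ltr0n.
have TN : T < N%:R.
  by apply: lt_le_trans (archi_boundP T0) _; rewrite ler_nat /N; do 2 apply: ltnW.
exists (Order.min (2 * r) (r / N%:R)); first by rewrite lt_min mulr_gt0 // divr_gt0.
move=> z hz v v0; apply: contrapT => hv.
have hz2 : in_polydisc p (2 * r) z by apply: in_polydisc_le hz; rewrite ge_min lexx.
have hzN : in_polydisc p (r / N%:R) z.
  by apply: in_polydisc_le hz; rewrite ge_min lexx orbT.
have vA : v *m A z = 0.
  apply/rowP => i; rewrite AE // mxE; apply/eqP/negP => /negP h.
  by apply: hv; exists i.
pose E := A p - A z.
have hE k i : modC (E k i) <= 12 / r / N%:R.
  rewrite /E /A !mxE modC_sub.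
  exact: (cauchy_partial_continuous r01 g1 gh i k N2 hzN).
have vE : v = v *m E *m W.
  by rewrite mulmxBr vA subr0 -mulmxA AW mulmx1.
pose S := \sum_k modC (v 0 k).
have S0 : 0 < S.
  rewrite lt_def; apply/andP; split; last by apply: sumr_ge0 => k _; exact: modC_ge0.
  apply: contra v0 => /eqP S0; apply/eqP/rowP => k; rewrite mxE.
  apply/eqP; rewrite -modC_eq0; apply/eqP.
  by apply: (psumr_eq0P _ S0) => // j _; exact: modC_ge0.
have vEi i : modC ((v *m E) 0 i) <= S * (12 / r / N%:R).
  rewrite mxE; apply: le_trans (modC_sum _ _ _) _; rewrite mulr_suml.
  by apply: ler_sum => k _; rewrite modCM ler_wpM2l ?modC_ge0.
have vk k : modC (v 0 k) <= S * (12 / r / N%:R) * w.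
  rewrite [in leLHS]vE mxE; apply: le_trans (modC_sum _ _ _) _.
  rewrite mulr_sumr; apply: ler_sum => i _; rewrite modCM.
  apply: ler_pM; rewrite ?modC_ge0 //.
  by rewrite (bigD1 k) //= lerDl sumr_ge0 // => j _; exact: modC_ge0.
have : S <= S * (T / N%:R).
  apply: le_trans (_ : \sum_(k < n) S * (12 / r / N%:R) * w <= _).
    by apply: ler_sum => k _; exact: vk.
  rewrite sumr_const card_ord -[leLHS]mulr_natl /T.
  by rewrite le_eqVlt; apply/orP; left; apply/eqP; field; rewrite !gt_eqF.
by rewrite ler_pMr // ler_pdivlMr // mul1r leNgt TN.
Qed.

End Nondegenerate.

(** Induction on the rank of a subspace: a functional that is nonzero on one of its vectors cuts out
    a kernel of smaller rank. *)
Lemma finite_nondegenerate (T : Type) (D : T -> {linear 'rV[CC R]_n -> CC R}) (t0 : T) :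
  (forall v : 'rV[CC R]_n, v != 0 -> exists t, D t v != 0) ->
  exists m (t : 'I_m -> T), forall v : 'rV[CC R]_n, v != 0 -> exists i, D (t i) v != 0.
Proof.
move=> hD.
pose col t : 'cV[CC R]_n := \col_k D t (delta_mx 0 k).
have colE t v : (v *m col t) 0 0 = D t v.
  rewrite [in RHS](row_sum_delta v) linear_sum mxE; apply: eq_bigr => k _.
  by rewrite linearZ mxE.
suff H d (U : 'M[CC R]_n) : (\rank U <= d)%N -> exists m (t : 'I_m -> T),
    forall v : 'rV[CC R]_n, (v <= U)%MS -> v != 0 -> exists i, D (t i) v != 0.
  have [m [t ht]] := H _ 1%:M (leqnn _); exists m, t => v v0.
  by apply: ht; rewrite ?submx1.
elim: d U => [|d IH] U rU.
  exists 0%N, (fun=> t0) => v vU; rewrite -submx0 => /negP[].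
  by apply: submx_trans vU _; rewrite submx0 -mxrank_eq0 -leqn0.
have [U0|Un0] := eqVneq U 0.
  by exists 0%N, (fun=> t0) => v; rewrite U0 submx0 => /eqP -> /eqP.
have /rowV0Pn[v vU vn0] := Un0.
have [t tv] := hD v vn0.
have rU' : (\rank (U :&: kermx (col t))%MS <= d)%N.
  rewrite -ltnS; apply: leq_trans rU; apply: rank_ltmx.
  rewrite ltmxE capmxSl /=; apply/negP => UU.
  have : (v <= kermx (col t))%MS by apply: submx_trans (submx_trans vU UU) (capmxSr _ _).
  by move=> /sub_kermxP vc; move: tv; rewrite -colE vc mxE eqxx.
have [m [s hs]] := IH _ rU'.
exists m.+1, (fun i => if unlift ord0 i is Some j then s j else t) => u uU un0.
have [ut|ut] := eqVneq (D t u) 0; last by exists ord0; rewrite unlift_none.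
have uK : (u <= U :&: kermx (col t))%MS.
  rewrite sub_capmx uU; apply/sub_kermxP/rowP => i.
  by rewrite (ord1 i) colE ut mxE.
by have [j hj] := hs u uK un0; exists (lift ord0 j); rewrite liftK.
Qed.

End Differential.

(** * Complex manifolds *)

Section WeightMean.
Variable R : realType.

Let weight (N k : nat) : R := 2^-1 ^+ k.+1.

Let weight_ge0 N k : 0 <= weight N k. Proof. by rewrite exprn_ge0. Qed.

Let weight_sum N : \sum_(k <- index_iota 0 N) weight N k <= 1.
Proof.
rewrite big_mkord; suff -> : \sum_(k < N) weight N k = 1 - 2^-1 ^+ N.
  by rewrite lerBlDr lerDl exprn_ge0.
rewrite /weight; elim: N => [|N IH]; first by rewrite big_ord0 expr0 subrr.
by rewrite big_ord_recr /= IH exprS; field.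
Qed.

(** For bounded u the truncated sums converge, so this is the sum of 2^-(k+1) u k, put into the form
    to which the results on means apply. *)
Definition weight_mean : mean R nat := limit_mean weight_ge0 weight_sum.

(** Limits preserve only weak inequalities; strictness comes from the fixed term of index k,
    contained in every truncation beyond k. *)
Lemma weight_mean_gt0 (u : nat -> R) k : bounded_function u ->
  (forall i, 0 <= u i) -> 0 < u k -> 0 < weight_mean u.
Proof.
move=> bu u0 uk; apply: (@lt_le_trans _ _ (2^-1 ^+ k.+1 * u k)).
  by rewrite mulr_gt0 // exprn_gt0.
rewrite -[leLHS]glim_cst; apply: glim_le.
- exact: bounded_cst.
- exact: bounded_sum_weights weight_ge0 weight_sum bu.
- exists k.+1 => N kN; rewrite big_mkord (bigD1 (Ordinal kN)) //= lerDl.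
  by apply: sumr_ge0 => i _; rewrite mulr_ge0.
Qed.

Definition weight_mean2 : mean R (nat * nat) :=
  bind_mean weight_mean (fun=> weight_mean).

Lemma weight_mean2_gt0 (u : nat * nat -> R) a : bounded_function u ->
  (forall i, 0 <= u i) -> 0 < u a -> 0 < weight_mean2 u.
Proof.
case: a => k l [B hB] u0 ukl.
have bu i : bounded_function (fun j => u (i, j)) by exists B.
apply: (@weight_mean_gt0 (fun i => weight_mean (fun j => u (i, j))) k).
- exists `|B| => i; apply: mean_abs_le => // j; exact: le_trans (hB _) (ler_norm _).
- by move=> i; apply: mean_ge0.
- exact: (weight_mean_gt0 (bu k) _ ukl).
Qed.

End WeightMean.

(** * Separating families of maps to the disc *)

Section Manifold.
Variables (R : realType) (n : nat) (M : complex_manifold R n).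
Implicit Types (c d : chart R n M) (f : M -> CC R) (x y : M).

Lemma chart_polydisc c x : dom c x -> exists2 e : R, 0 < e &
  forall q, in_polydisc (to_coord c x) e q -> exists2 y, dom c y & to_coord c y = q.
Proof.
move=> cx; have : nbhs (to_coord c x) (to_coord c @` dom c).
  by apply: open_nbhs_nbhs; split; [exact: cod_open|exists x].
move=> /nbhs_polydisc [e e0 he]; exists e => // q /he [y cy <-]; by exists y.
Qed.

Lemma holomorphic_differentiable f c y : holomorphic f -> atlas c -> dom c y ->
  differentiable (f \o of_coord c) (to_coord c y).
Proof. by move=> hf ac cy; exact: hf. Qed.

(** Chart maps have arbitrary values outside their domains, so a computation along a line must first
    be confined to small t, where the point stays in both domains. *)
Lemma of_coord_line c d y (v : 'rV[CC R]_n) : dom c y -> dom d y ->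
  exists2 e : R, 0 < e & forall t, modC t < e -> exists y',
    [/\ dom c y', dom d y', to_coord d y' = to_coord d y + t *: v
      & of_coord d (to_coord d y + t *: v) = y'].
Proof.
move=> cy dy; set u := to_coord d y.
have cu : (to_coord d @` dom d) u by exists y.
have : nbhs u ((to_coord d @` dom d) `&` (of_coord d @^-1` dom c)).
  apply: filterI; first by apply: open_nbhs_nbhs; split; [exact: cod_open|].
  apply: (of_coord_continuous cu); rewrite to_coordK //.
  by apply: open_nbhs_nbhs; split => //; exact: dom_open.
move=> /nbhs_polydisc [e e0 he].
pose S := \sum_k modC (v 0 k) + 1.
have S0 : 0 <= \sum_k modC (v 0 k) by apply: sumr_ge0 => k _; exact: modC_ge0.
exists (e / S); first by rewrite divr_gt0 // ltr_wpDl.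
move=> t; rewrite ltr_pdivlMr ?ltr_wpDl // => tS.
have [[y' dy' yE] cy'] : ((to_coord d @` dom d) `&` (of_coord d @^-1` dom c)) (u + t *: v).
  apply: he => k; rewrite !mxE addrAC subrr add0r modCM.
  apply: le_trans (ltW tS); rewrite ler_wpM2l ?modC_ge0 // /S.
  rewrite (bigD1 k) //= -addrA lerDl addr_ge0 // sumr_ge0 // => j _.
  exact: modC_ge0.
exists y'; rewrite -yE to_coordK //; split => //.
by move: cy'; rewrite /preimage /= -yE to_coordK.
Qed.

(** Here w is the image of v under the transition map T. It is nonzero because S undoes T near u:
    coordinate k of S o T along the line is u_k + t v_k, so w = 0 would force v_k = 0. *)
Lemma diff_change_chart c d y (v : 'rV[CC R]_n) : atlas c -> atlas d ->
  dom c y -> dom d y -> v != 0 -> exists2 w : 'rV[CC R]_n, w != 0 &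
    forall f, holomorphic f -> 'd (f \o of_coord d) (to_coord d y) v =
                          'd (f \o of_coord c) (to_coord c y) w.
Proof.
move=> ac ad cy dy v0; set u := to_coord d y.
have [e e0 he] := of_coord_line v cy dy.
pose T := to_coord c \o of_coord d; pose S := to_coord d \o of_coord c.
have Tu : T u = to_coord c y by rewrite /T /= to_coordK.
have dT : differentiable T u by exact: atlas_holomorphic.
have dS : differentiable S (T u) by rewrite Tu; exact: atlas_holomorphic.
exists ('d T u v).
  apply: contra v0 => /eqP w0; apply/eqP/rowP => k; rewrite mxE.
  pose coord (q : 'rV[CC R]_n) : CC R := q 0 k.
  have dcoord : differentiable coord (S (T u)) by exact: differentiable_coord.
  have dc : differentiable (coord \o S) (T u) := differentiable_comp dS dcoord.
  have := differentiable_cderive v (differentiable_comp dT dc).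
  rewrite (diff_comp dT dc) /= w0 linear0 => h0.
  apply: (cderive_unique (F := fun t => u 0 k + t * v 0 k) (w := 0)).
    move=> e' e'0; exists 1 => // t _.
    have -> : u 0 k + t * v 0 k - (u 0 k + 0 * v 0 k) - v 0 k * (t - 0) = 0 by ring.
    by rewrite modC0 mulr_ge0 ?modC_ge0 // ltW.
  apply: cderive_near e0 _ h0 => t te; have [y' [cy' dy' yE oE]] := he t te.
  by rewrite /= /coord /S /T /= oE to_coordK // yE !mxE.
move=> f hf; have df := holomorphic_differentiable hf ac cy; rewrite -Tu in df *.
have h1 := differentiable_cderive v (differentiable_comp dT df).
rewrite [X in cderive_at _ _ X](congr1 (fun D => D v) (diff_comp dT df)) in h1.
apply: (cderive_unique (F := fun t => (f \o of_coord d) (u + t *: v)) (w := 0)).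
  by apply: differentiable_cderive; exact: holomorphic_differentiable.
apply: cderive_near e0 _ h1 => t te; have [y' [cy' dy' yE oE]] := he t te.
by rewrite /= /T /= oE to_coordK.
Qed.

Lemma line_holomorphic_chart f c x (r : R) : holomorphic f -> atlas c ->
  (forall q, in_polydisc (to_coord c x) r q -> exists2 y, dom c y & to_coord c y = q) ->
  line_holomorphic (f \o of_coord c) (to_coord c x) r.
Proof.
move=> hf ac hr q /hr [y cy <-] v; apply: differentiable_cdiff.
exact: holomorphic_differentiable.
Qed.

Lemma to_disk0 : to_disk (fun _ : M => 0 : CC R).
Proof.
split=> [c ac x cx|y]; last by rewrite modC0.
exact: differentiable_cst.
Qed.

(** All charts are quantified over, so that separation on neighbourhoods found in different charts
    can be combined. *)
Definition separating_at (F : nat -> M -> CC R) y := forall c, atlas c -> dom c y ->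
  forall v : 'rV[CC R]_n, v != 0 ->
    exists i, 'd (F i \o of_coord c) (to_coord c y) v != 0.

Lemma locally_separating x : caratheodory_hyperbolic M ->
  exists2 F : nat -> M -> CC R, (forall i, to_disk (F i)) &
    \forall y \near x, separating_at F y.
Proof.
move=> hM; have [c ac cx] := atlas_cover x; set p := to_coord c x.
have [e e0 he] := chart_polydisc cx.
pose T := {f : M -> CC R | to_disk f}.
pose D (t : T) : {linear 'rV[CC R]_n -> CC R} := 'd (sval t \o of_coord c) p.
have hD (v : 'rV[CC R]_n) : v != 0 -> exists t, D t v != 0.
  move=> v0; have := hM x (Tangent ac cx v) v0.
  move=> /ereal_sup_gt [_ [f [fd fx] <-]]; rewrite lte_fin => hf.
  exists (exist _ f fd); apply: contraTN hf => /eqP D0.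
  rewrite /poincare_norm -leNgt /mdiff /=.
  have -> : 'd (f \o of_coord c) (to_coord c x) v = 0 by exact: D0.
  by rewrite modC0 mul0r.
have [m [t ht]] := finite_nondegenerate (exist _ _ to_disk0 : T) hD.
pose r : R := Order.min 1 (e / 3).
have r01 : 0 < r <= 1 by rewrite lt_min ltr01 divr_gt0 // ge_min lexx.
have re3 : 3 * r <= e.
  have : r <= e / 3 by rewrite ge_min lexx orbT.
  by lra.
pose g i := sval (t i) \o of_coord c.
have hg i : to_disk (sval (t i)) by exact: svalP.
have g1 i u : modC (g i u) <= 1 by exact: ltW ((hg i).2 _).
have gh i : line_holomorphic (g i) p (3 * r).
  apply: line_holomorphic_chart => //; first exact: (hg i).1.
  by move=> q hq; apply: he; exact: in_polydisc_le hq.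
have gd i q : in_polydisc p (2 * r) q -> differentiable (g i) q.
  move=> hq; have [|y cy <-] := he q.
    apply: in_polydisc_le hq; apply: le_trans re3.
    by case/andP: r01 => r0 _; rewrite ler_wpM2r ?ler_nat // ltW.
  exact: holomorphic_differentiable (hg i).1 ac cy.
have [d d0 hd] := nondegenerate_near r01 g1 gh gd ht.
(* The finite family is padded with the zero map, so that every point yields a sequence of the same
   type. *)
exists (fun k => if insub k is Some i then sval (t i) else fun=> 0).
  by move=> k; case: insubP => [i _ _|_]; [exact: hg|exact: to_disk0].
have nx : nbhs x (dom c `&` (to_coord c @^-1` [set q | in_polydisc p d q])).
  apply: filterI; first by apply: open_nbhs_nbhs; split => //; exact: dom_open.
  by apply: (to_coord_continuous cx); apply/nbhs_polydisc; exists d.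
apply: filterS nx => y [cy yd] c' ac' cy' v v0.
have [w w0 hw] := diff_change_chart ac ac' cy cy' v0.
have [i hi] := hd _ yd w w0.
exists i; rewrite insubT //= => iM.
have -> : Sub (i : nat) iM = i by apply: val_inj.
by rewrite hw //; exact: (hg i).1.
Qed.

(** Each integer k selects one sequence, separating on all of the basic open set coded by k whenever
    such a sequence exists, and zero maps if k codes no such set. The basic sets lying in a
    neighbourhood given by [locally_separating] cover M. *)
Lemma countably_separating : caratheodory_hyperbolic M ->
  exists F : nat * nat -> M -> CC R, (forall a, to_disk (F a)) /\
    forall x c, atlas c -> dom c x -> forall v : 'rV[CC R]_n, v != 0 ->
      exists a, 'd (F a \o of_coord c) (to_coord c x) v != 0.
Proof.
move=> hM; have [B /countable_injP [code codeI] [Bo Bb]] := @manifold_second_countable _ _ M.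
pose ok (b : set M) (F : nat -> M -> CC R) :=
  (forall i, to_disk (F i)) /\ forall y, b y -> separating_at F y.
have /choice [H hH] : forall k, exists F : nat -> M -> CC R, (forall i, to_disk (F i)) /\
    forall b, B b -> code b = k -> (exists F', ok b F') -> ok b F.
  move=> k; have [[b [Bb' bk [F hF]]]|nb] :=
    pselect (exists b, [/\ B b, code b = k & exists F', ok b F']).
    exists F; split; first exact: hF.1.
    move=> b' Bb'' bk' _; suff -> : b' = b by [].
    by apply: codeI; [exact: mem_set|exact: mem_set|rewrite bk bk'].
  exists (fun _ _ => 0); split; first by move=> i; exact: to_disk0.
  by move=> b Bb' bk hb; case: nb; exists b.
exists (fun a => H a.1 a.2); split; first by move=> a; exact: (hH a.1).1.
move=> x c ac cx v v0; have [F Fd Fs] := locally_separating x hM.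
have [b [Bb' bx] bF] := Bb x _ Fs.
have [_ /(_ b Bb' erefl) hb] := hH (code b).
have [|_ hs] := hb; first by exists F; split => // y; exact: bF.
by have [i hi] := hs x bx c ac cx v v0; exists (code b, i).
Qed.

End Manifold.

Theorem theorem0p1 (R : realType) (n : nat) (M : complex_manifold R n)
    (hM : caratheodory_hyperbolic M) :
  exists phi : M -> R,
    [/\ bounded_function phi, real_analytic phi
      & strictly_plurisubharmonic phi].
Proof.
have [F [Fd Fs]] := countably_separating hM.
have F1 a y : modC (F a y) <= 1 by exact: ltW ((Fd a).2 y).
pose phi y := weight_mean2 R (fun a => modC (F a y) ^+ 2).
have sq1 a y : `|modC (F a y) ^+ 2| <= 1.
  by rewrite ger0_norm ?exprn_ge0 ?exprn_ile1 ?modC_ge0.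
have phiE c : phi \o of_coord c = mean_sq (weight_mean2 R) (fun a => F a \o of_coord c).
  by [].
(* The radius min (1, e / 3) keeps the polydisc of radius 3 r inside the chart and r at most 1, as
   the Levi form computation requires. *)
have local c x : atlas c -> dom c x -> exists r : R, [/\ 0 < r <= 1,
    forall a, line_holomorphic (F a \o of_coord c) (to_coord c x) (3 * r)
  & forall a q, in_polydisc (to_coord c x) (2 * r) q ->
      differentiable (F a \o of_coord c) q].
  move=> ac cx; have [e e0 he] := chart_polydisc cx.
  have r01 : 0 < Order.min 1 (e / 3) <= 1.
    by rewrite lt_min ltr01 divr_gt0 // ge_min lexx.
  have re : Order.min 1 (e / 3) <= e / 3 by rewrite ge_min lexx orbT.
  exists (Order.min 1 (e / 3)); split => // [a|a q hq].
    apply: line_holomorphic_chart (Fd a).1 ac _ => q hq; apply: he.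
    by apply: in_polydisc_le hq; lra.
  have [|y cy <-] := he q; first by apply: in_polydisc_le hq; move: r01 re; lra.
  exact: holomorphic_differentiable (Fd a).1 ac cy.
exists phi; split.
- by exists 1 => y; apply: mean_abs_le.
- move=> c ac x cx; have [r [/andP[r0 _] hr _]] := local c x ac cx.
  rewrite phiE; apply: real_analytic_mean_sq hr; last by rewrite mulr_gt0.
  by move=> a u; exact: F1.
- move=> c ac x cx v v0; have [r [r01 hr hd]] := local c x ac cx.
  have g1 a (u : 'rV[CC R]_n) : modC ((F a \o of_coord c) u) <= 1 by exact: F1.
  rewrite phiE (levi_form_mean_sq _ g1 r01 hr) -(realC0 R) ltr_realC.
  have [a ha] := Fs x c ac cx v v0.
  have r0 : 0 < r by case/andP: r01.
  apply: (weight_mean2_gt0 (a := a)).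
  + have [B hB] : cbounded (fun a => \sum_j v 0 j *
      cauchy_partial (F a \o of_coord c) r (to_coord c x) j).
      apply: cbounded_sum => j; apply: cboundedZ; exists (2 / r) => b.
      exact: modC_partial g1 r01 _ _ _.
    exists (B ^+ 2) => b; rewrite ger0_norm ?exprn_ge0 ?modC_ge0 //.
    by rewrite lerXn2r ?nnegrE ?modC_ge0 // (le_trans (modC_ge0 _) (hB b)).
  + by move=> b; rewrite exprn_ge0 ?modC_ge0.
  + rewrite exprn_gt0 // modC_gt0.
    have pp : in_polydisc (to_coord c x) (2 * r) (to_coord c x).
      by move=> k; rewrite subrr modC0 mulr_ge0 // ltW.
    (* The single function is viewed as a family indexed by [unit], and its Cauchy expression
       becomes the differential that [Fs] shows to be nonzero. *)
    have E := diff_cauchy_partial (g := fun _ : unit => F a \o of_coord c) r01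
      (fun _ => g1 a) (fun _ => hr a) (fun _ => hd a) tt v pp.
    by rewrite -E.
Qed.
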